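(* A countable group $G$ is hyperlinear if and only if for every $g\in G\setminus\{e\}$ there is a hyperlinear pair $(G,\varphi_g)$ such that $|\varphi_g(g)|<1$.
   Context: $R$ is the hyperfinite type $II_1$ factor; for a free ultrafilter $\rho$ on $\mathbb N$, $R^\rho$ is the tracial ultrapower of $R$, $\tau$ its trace, $U(R^\rho)$ its unitary group. A central pair is $(G,\varphi)$ with $G$ a group and $\varphi:G\to\mathbb C$ positive definite, constant on conjugacy classes, with $\varphi(e)=1$. It is a hyperlinear pair if there is a homomorphism $\theta_\varphi:G\to U(R^\rho)$, for some free ultrafilter $\rho$ on $\mathbb N$, with $\tau(\theta_\varphi(g))=\varphi(g)$ for all $g\in G$. A group $G$ is hyperlinear if $(G,\delta_e)$ is a hyperlinear pair, where $\delta_e(e)=1$ and $\delta_e(g)=0$ for $g\ne e$. *)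

(* Defs.v *)
From HB Require Import structures.
From mathcomp Require Import all_boot all_order all_algebra.
From mathcomp Require Import all_classical all_reals all_analysis.
From mathcomp Require Import complex ring lra.
Set Implicit Arguments.
Unset Strict Implicit.
Unset Printing Implicit Defensive.
Import Order.TTheory GRing.Theory Num.Theory.
Import numFieldNormedType.Exports.
Local Open Scope classical_set_scope.
Local Open Scope ring_scope.

Notation normc := ComplexField.Normc.normc.

Section Sums.
Variables (K : realType) (T : choiceType).
Implicit Types (f g p q : T -> K) (r : K).

Definition rsummable f := summable [set: T] (EFin \o f).

(* The sum of an absolutely summable real family, as the difference of the
   sums of its positive and negative parts. *)
Definition rsum f : K :=
  fine (\esum_(t in [set: T]) (EFin \o f)^\+ t -
        \esum_(t in [set: T]) (EFin \o f)^\- t)%E.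

Definition csum (f : T -> K[i]) : K[i] :=
  Complex (rsum (fun t => complex.Re (f t))) (rsum (fun t => complex.Im (f t))).

Lemma rsummable_le f g : (forall t, `|f t| <= `|g t|) -> rsummable g -> rsummable f.
Proof.
move=> fg; apply: le_lt_trans; apply: le_esum => t _ /=.
by rewrite lee_fin fg.
Qed.

Lemma rsummableD f g : rsummable f -> rsummable g -> rsummable (fun t => f t + g t).
Proof. by move=> sf sg; exact: (summableD sf sg). Qed.

Lemma rsummableN f : rsummable f -> rsummable (fun t => - f t).
Proof. by apply: rsummable_le => t; rewrite normrN. Qed.

Lemma esumZ r f : 0 <= r -> (forall t, 0 <= f t) ->
  \esum_(t in [set: T]) (r * f t)%:E = (r%:E * \esum_(t in [set: T]) (f t)%:E)%E.
Proof.
move=> r0 f0; rewrite /esum -ereal_supZl//; last first.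
  by apply/set0P; exists (\sum_(x \in set0) (f x)%:E)%E, set0 => //; exact: fsets_set0.
congr ereal_sup; apply/seteqP; split => [_ [A [fA _] <-]|_ [_ [A [fA _] <-] <-]] /=.
- exists (\sum_(x \in A) (f x)%:E)%E; first by exists A.
  rewrite !fsbig_finite//= ge0_sume_distrr//.
  by move=> i _; rewrite lee_fin.
- exists A => //.
  rewrite !fsbig_finite//= ge0_sume_distrr//.
  by move=> i _; rewrite lee_fin.
Qed.

Lemma rsummableZ r f : rsummable f -> rsummable (fun t => r * f t).
Proof.
rewrite /rsummable /summable => sf.
rewrite (eq_esum (b := fun t => (`|r| * `|f t|)%:E)); last first.
  by move=> t _ /=; rewrite normrM.
rewrite esumZ//.
have : \esum_(t in [set: T]) `|f t|%:E \is a fin_num.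
  by rewrite ge0_fin_numE//; apply: esum_ge0 => t _; rewrite lee_fin.
by move/fineK => <-; rewrite -EFinM ltry.
Qed.

Lemma ge0_rsummableE f : (forall t, 0 <= f t) ->
  rsummable f <-> (\esum_(t in [set: T]) (f t)%:E < +oo)%E.
Proof.
move=> f0; rewrite /rsummable /summable.
by rewrite (eq_esum (b := fun t => (f t)%:E))// => t _ /=; rewrite ger0_norm.
Qed.

Lemma rsumB_ge0 p q : (forall t, 0 <= p t) -> (forall t, 0 <= q t) ->
  rsummable p -> rsummable q ->
  rsum (fun t => p t - q t) =
  fine (\esum_(t in [set: T]) (p t)%:E) - fine (\esum_(t in [set: T]) (q t)%:E).
Proof.
move=> p0 q0 sp sq.
have fin g : (forall t, 0 <= g t) -> rsummable g ->
    \esum_(t in [set: T]) (g t)%:E \is a fin_num.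
  move=> g0 /(ge0_rsummableE g0) sg; rewrite ge0_fin_numE//.
  by apply: esum_ge0 => t _; rewrite lee_fin.
rewrite -fineB ?fin//; congr fine.
by rewrite -(esumB sp sq)// => t _ /=; rewrite lee_fin.
Qed.

Lemma rsum_ge0E f : (forall t, 0 <= f t) -> rsummable f ->
  rsum f = fine (\esum_(t in [set: T]) (f t)%:E).
Proof.
move=> f0 sf.
have s0 : rsummable (fun=> 0 : K).
  by apply: rsummable_le sf => t; rewrite normr0.
rewrite -[LHS](_ : rsum (fun t => f t - 0) = _); last first.
  by congr rsum; apply/funext => t; rewrite subr0.
rewrite rsumB_ge0// (esum1 (a := fun=> 0%:E)) ?subr0//.
Qed.

Lemma rsum_ge0 f : (forall t, 0 <= f t) -> rsummable f -> 0 <= rsum f.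
Proof.
move=> f0 sf; rewrite rsum_ge0E// fine_ge0//.
by apply: esum_ge0 => t _; rewrite lee_fin.
Qed.

Lemma rsumD_ge0 p q : (forall t, 0 <= p t) -> (forall t, 0 <= q t) ->
  rsummable p -> rsummable q ->
  rsum (fun t => p t + q t) = rsum p + rsum q.
Proof.
move=> p0 q0 sp sq.
rewrite !rsum_ge0E//; last 2 first.
- by move=> t; rewrite addr_ge0.
- exact: rsummableD.
have fin g : (forall t, 0 <= g t) -> rsummable g ->
    \esum_(t in [set: T]) (g t)%:E \is a fin_num.
  move=> g0 /(ge0_rsummableE g0) sg; rewrite ge0_fin_numE//.
  by apply: esum_ge0 => t _; rewrite lee_fin.
rewrite -fineD ?fin//; congr fine.
by rewrite -esumD// => t _; rewrite lee_fin.
Qed.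

Lemma rsum_pos_neg f : rsummable f ->
  exists p q, [/\ forall t, 0 <= p t, forall t, 0 <= q t,
    rsummable p, rsummable q & f = fun t => p t - q t].
Proof.
move=> sf; exists (fun t => `|f t| + f t), (fun t => `|f t|); split => //.
- by move=> t; rewrite -lerBlDr sub0r ler_normr lexx orbT.
- apply: rsummableD => //; apply: rsummable_le sf => t; by rewrite normr_id.
- by apply: rsummable_le sf => t; rewrite normr_id.
- by apply/funext => t; ring.
Qed.

Lemma rsumD f g : rsummable f -> rsummable g ->
  rsum (fun t => f t + g t) = rsum f + rsum g.
Proof.
move=> /rsum_pos_neg[p [q [p0 q0 sp sq ->]]].
move=> /rsum_pos_neg[p' [q' [p'0 q'0 sp' sq' ->]]].
rewrite !rsumB_ge0// -!rsum_ge0E//.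
rewrite [X in rsum X](_ : _ = fun t => (p t + p' t) - (q t + q' t)); last first.
  by apply/funext => t; ring.
rewrite rsumB_ge0 -?rsum_ge0E ?rsumD_ge0//;
  try (by move=> t; rewrite addr_ge0); try exact: rsummableD.
by ring.
Qed.

Lemma rsumN f : rsummable f -> rsum (fun t => - f t) = - rsum f.
Proof.
move=> /rsum_pos_neg[p [q [p0 q0 sp sq ->]]].
rewrite rsumB_ge0// [X in rsum X](_ : _ = fun t => q t - p t); last first.
  by apply/funext => t; ring.
by rewrite rsumB_ge0//; ring.
Qed.

Lemma rsumZ r f : rsummable f -> rsum (fun t => r * f t) = r * rsum f.
Proof.
move=> sf; have ge0 a : 0 <= a -> rsum (fun t => a * f t) = a * rsum f.
  move=> a0; move: sf => /rsum_pos_neg[p [q [p0 q0 sp sq ->]]].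
  rewrite [X in rsum X](_ : _ = fun t => a * p t - a * q t); last first.
    by apply/funext => t; ring.
  rewrite (rsumB_ge0 (p := fun t => a * p t) (q := fun t => a * q t));
    try (by move=> t; rewrite mulr_ge0); try exact: rsummableZ.
  have fin g : (forall t, 0 <= g t) -> rsummable g ->
      \esum_(t in [set: T]) (g t)%:E \is a fin_num.
    move=> g0 /(ge0_rsummableE g0) sg; rewrite ge0_fin_numE//.
    by apply: esum_ge0 => t _; rewrite lee_fin.
  by rewrite (rsumB_ge0 (p := p) (q := q))// !esumZ// !fineM ?fin//= mulrBr.
have [r0|/ltW r0] := leP 0 r; first exact: ge0.
rewrite [X in rsum X](_ : _ = fun t => - (- r * f t)); last first.
  by apply/funext => t; ring.
by rewrite rsumN ?ge0 ?oppr_ge0//; [ring|exact: rsummableZ].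
Qed.

Lemma ler_rsum f g : rsummable f -> rsummable g -> (forall t, f t <= g t) ->
  rsum f <= rsum g.
Proof.
move=> sf sg fg; rewrite -subr_ge0 -rsumN// -rsumD//; last exact: rsummableN.
by apply: rsum_ge0 => [t|]; rewrite ?subr_ge0//; exact/rsummableD/rsummableN.
Qed.

Lemma rsum1 f t0 : (forall t, t != t0 -> f t = 0) -> rsum f = f t0.
Proof.
move=> f0; rewrite /rsum.
have key (h : T -> \bar K) : (forall t, 0 <= h t)%E ->
    (forall t, t != t0 -> h t = 0)%E -> \esum_(t in [set: T]) h t = h t0.
  move=> h0 hn; rewrite -(esum_set1 (h0 t0)).
  rewrite [RHS]esum_mkcond; apply: eq_esum => t _.
  case: ifPn => //; rewrite notin_setE => /= /eqP; exact: hn.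
rewrite !key//.
- have -> : ((EFin \o f)^\+ t0 - (EFin \o f)^\- t0 = (f t0)%:E)%E.
    by rewrite [RHS](congr1 (fun h => h t0) (funeposneg (EFin \o f))).
  by [].
- by move=> t tt0; rewrite funenegE /= f0// oppr0 maxxx.
- by move=> t tt0; rewrite funeposE /= f0// maxxx.
Qed.

Lemma rsummable1 f t0 : (forall t, t != t0 -> f t = 0) -> rsummable f.
Proof.
move=> f0; rewrite /rsummable /summable esum_mkcond.
rewrite (eq_esum (b := fun t => if t \in [set t0] then (`|f t0|%:E) else 0%E)).
  by rewrite -esum_mkcond esum_set1 ?ltry ?lee_fin.
move=> t _; rewrite mem_setT; case: ifPn => [|]; first by rewrite inE => ->.
by rewrite notin_setE => /= /eqP/f0 ->; rewrite normr0.
Qed.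

Lemma rsummable_bij f (e : T -> T) : bijective e ->
  rsummable f -> rsummable (fun t => f (e t)).
Proof.
move=> be; have se : set_bij [set: T] [set: T] e by rewrite setTT_bijective.
by rewrite /rsummable /summable (reindex_esum _ _ _ _ se).
Qed.

Lemma rsum_bij f (e : T -> T) : bijective e -> rsum (fun t => f (e t)) = rsum f.
Proof.
move=> be; have se : set_bij [set: T] [set: T] e by rewrite setTT_bijective.
rewrite /rsum (reindex_esum _ _ _ (EFin \o f)^\+%E se).
  rewrite (reindex_esum _ _ _ (EFin \o f)^\-%E se).
    by congr (fine (_ - _)%E); apply: eq_esum => t _;
      rewrite ?funeposE ?funenegE.
all: by [].
Qed.

End Sums.

Section Ell2.
Variables (K : realType) (T : choiceType).
Implicit Types (f g : T -> K[i]).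

Lemma sqr_normcE (z : K[i]) :
  normc z ^+ 2 = complex.Re z ^+ 2 + complex.Im z ^+ 2.
Proof. by case: z => a b; rewrite /= sqr_sqrtr// addr_ge0// sqr_ge0. Qed.

Definition square_summable f := rsummable (fun t => normc (f t) ^+ 2).

Definition l2_pred : {pred T -> K[i]} := fun f => `[< square_summable f >].

Fact l2_submod : submod_closed l2_pred.
Proof.
split; first by apply/asboolP; rewrite /square_summable;
  apply/ge0_rsummableE => [t|]; rewrite ?sqr_ge0// esum1// => t _;
  rewrite sqr_normcE/= expr0n/= addr0.
move=> a f g /asboolP sf /asboolP sg; apply/asboolP.
pose h t := (2 * normc a ^+ 2) * normc (f t) ^+ 2 + 2 * normc (g t) ^+ 2.
apply: (@rsummable_le _ _ _ h); last by apply: rsummableD; exact: rsummableZ.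
move=> t; rewrite ger0_norm ?sqr_ge0//; apply: le_trans (ler_norm _).
have -> : (a *: f + g) t = a * f t + g t by [].
rewrite /h {h} !sqr_normcE /=.
case: a (f t) (g t) => [a1 a2] [f1 f2] [g1 g2] /=.
rewrite -subr_ge0.
rewrite (_ : _ - _ = (a1 * f1 - a2 * f2 - g1) ^+ 2 + (a1 * f2 + a2 * f1 - g2) ^+ 2); last by ring.
by rewrite addr_ge0// sqr_ge0.
Qed.

HB.instance Definition _ := GRing.isSubmodClosed.Build K[i] (T -> K[i]) l2_pred l2_submod.

Record l2 := L2 { l2fun :> T -> K[i]; _ : l2fun \in l2_pred }.
HB.instance Definition _ := [isSub for l2fun].
HB.instance Definition _ := [Choice of l2 by <:].
HB.instance Definition _ := [SubChoice_isSubLmodule of l2 by <:].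

Implicit Types xi eta : l2.

Lemma l2P xi : square_summable xi.
Proof. by case: xi => f /= /asboolP. Qed.

Lemma l2_ext xi eta : (forall t, xi t = eta t) -> xi = eta.
Proof. by move=> h; apply/val_inj/funext. Qed.

Definition l2norm xi : K := Num.sqrt (rsum (fun t => normc (xi t) ^+ 2)).

Definition inner xi eta : K[i] := csum (fun t => xi t * conjc (eta t)).

Lemma l2D xi eta t : (xi + eta) t = xi t + eta t. Proof. by []. Qed.
Lemma l2B xi eta t : (xi - eta) t = xi t - eta t. Proof. by []. Qed.
Lemma l2Z a xi t : (a *: xi) t = a * xi t. Proof. by []. Qed.

Lemma l2_sumE xi : l2norm xi ^+ 2 = rsum (fun t => normc (xi t) ^+ 2).
Proof.
by rewrite sqr_sqrtr// rsum_ge0//; [move=> t; rewrite sqr_ge0|exact: l2P].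
Qed.

Lemma l2norm_ge0 xi : 0 <= l2norm xi. Proof. exact: sqrtr_ge0. Qed.

Lemma inner_summable xi eta :
  rsummable (fun t => complex.Re (xi t * conjc (eta t))) /\
  rsummable (fun t => complex.Im (xi t * conjc (eta t))).
Proof.
pose h t := normc (xi t) ^+ 2 + normc (eta t) ^+ 2.
have sh : rsummable h by apply: rsummableD; exact: l2P.
have le (x y u v : K) : `|x * u + y * v| <= (x ^+ 2 + y ^+ 2) + (u ^+ 2 + v ^+ 2).
  rewrite ler_norml -[X in X && _]subr_ge0 -[X in _ && X]subr_ge0.
  apply/andP; split.
  - rewrite (_ : _ - _ = ((x + u) ^+ 2 + (y + v) ^+ 2 +
        (x ^+ 2 + y ^+ 2 + u ^+ 2 + v ^+ 2)) / 2); last by field.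
    by rewrite divr_ge0// !addr_ge0// sqr_ge0.
  - rewrite (_ : _ - _ = ((x - u) ^+ 2 + (y - v) ^+ 2 +
        (x ^+ 2 + y ^+ 2 + u ^+ 2 + v ^+ 2)) / 2); last by field.
    by rewrite divr_ge0// !addr_ge0// sqr_ge0.
split; apply: rsummable_le sh => t; rewrite [leRHS]ger0_norm
  ?addr_ge0 ?sqr_ge0// /h {h} !sqr_normcE;
  case: (xi t) (eta t) => [a b] [c d] /=.
- by rewrite mulrN opprK le.
- by have := le a b (- d) c; rewrite sqrrN (addrC (d ^+ 2)) // [b * c + _]addrC.
Qed.

Lemma inner_conj xi eta : inner eta xi = conjc (inner xi eta).
Proof.
have [_ sI] := inner_summable xi eta.
rewrite /inner /csum /= -rsumN//; congr Complex; congr rsum; apply/funext => t;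
  by case: (xi t) (eta t) => [a b] [c d] /=; ring.
Qed.

Lemma innerDl xi zeta eta : inner (xi + zeta) eta = inner xi eta + inner zeta eta.
Proof.
have [sR sI] := inner_summable xi eta; have [sR' sI'] := inner_summable zeta eta.
rewrite /inner /csum; apply/eqP; rewrite eq_complex; apply/andP.
by split; apply/eqP; rewrite [RHS]/= -rsumD//; congr rsum; apply/funext => t;
  rewrite l2D; case: (xi t) (zeta t) (eta t) => [? ?] [? ?] [? ?] /=; ring.
Qed.

Lemma innerZl a xi eta : inner (a *: xi) eta = a * inner xi eta.
Proof.
have [sR sI] := inner_summable xi eta; case: a => a b.
rewrite /inner /csum; apply/eqP; rewrite eq_complex; apply/andP; split; apply/eqP.
- transitivity (a * rsum (fun t => complex.Re (xi t * conjc (eta t))) +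
    (- b) * rsum (fun t => complex.Im (xi t * conjc (eta t)))); last first.
    by rewrite /= mulNr.
  rewrite -!rsumZ// -rsumD; try exact: rsummableZ.
  congr rsum; apply/funext => t; rewrite l2Z.
  by case: (xi t) (eta t) => [x1 x2] [y1 y2] /=; ring.
- transitivity (a * rsum (fun t => complex.Im (xi t * conjc (eta t))) +
    b * rsum (fun t => complex.Re (xi t * conjc (eta t)))); last first.
    by [].
  rewrite -!rsumZ// -rsumD; try exact: rsummableZ.
  congr rsum; apply/funext => t; rewrite l2Z.
  by case: (xi t) (eta t) => [x1 x2] [y1 y2] /=; ring.
Qed.

Lemma innerNl xi eta : inner (- xi) eta = - inner xi eta.
Proof. by rewrite -scaleN1r innerZl mulN1r. Qed.

Lemma innerBl xi zeta eta : inner (xi - zeta) eta = inner xi eta - inner zeta eta.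
Proof. by rewrite innerDl innerNl. Qed.

Lemma innerBr eta xi zeta : inner eta (xi - zeta) = inner eta xi - inner eta zeta.
Proof.
by rewrite inner_conj innerBl (inner_conj xi eta) (inner_conj zeta eta) raddfB.
Qed.

Lemma inner_norm xi : complex.Re (inner xi xi) = l2norm xi ^+ 2.
Proof.
rewrite l2_sumE /=; congr rsum; apply/funext => t; rewrite sqr_normcE.
by case: (xi t) => a b /=; ring.
Qed.

Fact delta_subproof (t : T) : (fun s => (s == t)%:R : K[i]) \in l2_pred.
Proof.
apply/asboolP/(@rsummable1 _ _ _ t) => s /negbTE ->.
by rewrite sqr_normcE /= expr0n addr0.
Qed.
Definition delta (t : T) : l2 := L2 (delta_subproof t).

Lemma inner_delta xi t : inner xi (delta t) = xi t.
Proof.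
rewrite /inner /csum (rsum1 (t0 := t)); last first.
  by move=> s /negbTE /= ->; rewrite conjc0 mulr0.
rewrite (rsum1 (t0 := t)); last first.
  by move=> s /negbTE /= ->; rewrite conjc0 mulr0.
by rewrite /= eqxx; case: (xi t) => a b /=; rewrite oppr0 !mulr0 !mulr1 subr0 add0r.
Qed.

Lemma le_l2norm xi t : normc (xi t) <= l2norm xi.
Proof.
rewrite -(@ler_pXn2r _ 2)// ?nnegrE ?l2norm_ge0//; last first.
  by case: (xi t) => a b; exact: sqrtr_ge0.
rewrite l2_sumE.
pose g s := if s == t then normc (xi t) ^+ 2 else 0.
have g0 s : s != t -> g s = 0 by rewrite /g => /negbTE ->.
rewrite [leLHS](_ : _ = rsum g); last by rewrite (rsum1 g0) /g eqxx.
apply: ler_rsum; [exact: rsummable1 g0|exact: l2P|] => s; rewrite /g.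
by case: eqP => [->|_]; rewrite ?sqr_ge0.
Qed.

Lemma l2normD_sqr xi eta :
  l2norm (xi + eta) ^+ 2 <= 2 * l2norm xi ^+ 2 + 2 * l2norm eta ^+ 2.
Proof.
rewrite !l2_sumE -!rsumZ; try exact: l2P.
rewrite -rsumD; try (apply: rsummableZ; exact: l2P).
apply: ler_rsum; first exact: l2P.
  by apply: rsummableD; apply: rsummableZ; exact: l2P.
move=> t; rewrite l2D !sqr_normcE; case: (xi t) (eta t) => [a b] [c d] /=.
rewrite -subr_ge0 (_ : _ - _ = (a - c) ^+ 2 + (b - d) ^+ 2); last by ring.
by rewrite addr_ge0// sqr_ge0.
Qed.

Lemma l2normD2 xi eta : l2norm (xi + eta) <= 2 * l2norm xi + 2 * l2norm eta.
Proof.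
have := l2normD_sqr xi eta; have := l2norm_ge0 (xi + eta).
have := l2norm_ge0 xi; have := l2norm_ge0 eta.
move: (l2norm (xi + eta)) (l2norm xi) (l2norm eta) => c a b b0 a0 c0 h.
rewrite -(@ler_pXn2r _ 2)// ?nnegrE ?addr_ge0 ?mulr_ge0//.
by apply: le_trans h _; have := mulr_ge0 a0 b0;
  have := sqr_ge0 a; have := sqr_ge0 b; lra.
Qed.

Lemma l2norm0 : l2norm 0 = 0.
Proof.
rewrite /l2norm [X in rsum X](_ : _ = fun t => 0 * normc ((0 : l2) t) ^+ 2).
  by rewrite rsumZ ?mul0r ?sqrtr0//; exact: l2P.
by apply/funext => t; rewrite sqr_normcE /= expr0n addr0 mul0r.
Qed.

Lemma l2normN xi : l2norm (- xi) = l2norm xi.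
Proof.
congr (Num.sqrt (rsum _)); apply/funext => t; have -> : (- xi) t = - xi t by [].
by rewrite !sqr_normcE; case: (xi t) => a b /=; rewrite !sqrrN.
Qed.

Lemma inner_le xi eta (c : K) : 0 < c ->
  2 * complex.Re (inner xi eta) <= c * l2norm xi ^+ 2 + c^-1 * l2norm eta ^+ 2.
Proof.
move=> c0; have [sR _] := inner_summable xi eta.
rewrite !l2_sumE /inner /csum /= -!rsumZ//; try exact: l2P.
rewrite -rsumD; try (apply: rsummableZ; exact: l2P).
apply: ler_rsum; first exact: rsummableZ.
  by apply: rsummableD; apply: rsummableZ; exact: l2P.
move=> t; rewrite !sqr_normcE; case: (xi t) (eta t) => [a b] [d e] /=.
rewrite -subr_ge0 (_ : _ - _ = c^-1 * ((c * a - d) ^+ 2 + (c * b - e) ^+ 2)).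
  by rewrite mulr_ge0 ?addr_ge0 ?sqr_ge0// invr_ge0 ltW.
by field; rewrite gt_eqF.
Qed.

End Ell2.

Arguments delta {K T} t.

Section Bounded.
Variables (K : realType) (T : choiceType).
Local Notation H := (l2 K T).

(* The adjoint bstar is determined by bfun (see bop_ext), and it exists for
   every bounded linear map since l2 is complete. *)
Record bop := Bop {
  bfun :> H -> H;
  bstar : H -> H;
  bop_linear : linear bfun;
  bop_bounded : exists M : K, forall xi, l2norm (bfun xi) <= M * l2norm xi;
  bop_adjoint : forall xi eta, inner (bfun xi) eta = inner xi (bstar eta) }.

Implicit Types x y z : bop.

Lemma bstarE x eta t : bstar x eta t = conjc (inner (x (delta t)) eta).
Proof. by rewrite bop_adjoint -inner_conj inner_delta. Qed.

Lemma bop_ext x y : bfun x =1 bfun y -> x = y.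
Proof.
move=> xy; have xyf : bfun x = bfun y by exact/funext.
have xys : bstar x = bstar y.
  by apply/funext => eta; apply: l2_ext => t; rewrite !bstarE xyf.
case: x y xyf xys {xy} => [f f' fl fb fa] [g g' gl gb ga] /= fg fg'.
by subst g g'; congr Bop; exact: Prop_irrelevance.
Qed.

Lemma bstar_adjoint x xi eta : inner (bstar x xi) eta = inner xi (x eta).
Proof. by rewrite inner_conj -bop_adjoint -inner_conj. Qed.

Lemma bop_bounded_gt0 x :
  exists2 M : K, 0 < M & forall xi, l2norm (x xi) <= M * l2norm xi.
Proof.
have [M xM] := bop_bounded x; exists (`|M| + 1); first by rewrite ltr_wpDl.
move=> xi; apply: le_trans (xM xi) _; rewrite ler_wpM2r ?l2norm_ge0//.
by rewrite (le_trans (ler_norm M))// lerDl.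
Qed.

Lemma bstar_le x (M : K) : 0 < M -> (forall xi, l2norm (x xi) <= M * l2norm xi) ->
  forall eta, l2norm (bstar x eta) <= M * l2norm eta.
Proof.
move=> M0 xM eta; set zeta := bstar x eta.
rewrite -(@ler_pXn2r _ 2)// ?nnegrE ?mulr_ge0 ?l2norm_ge0// ?(ltW M0)//.
have := inner_le (x zeta) eta (c := (M ^+ 2)^-1).
rewrite bop_adjoint inner_norm invr_gt0 exprn_gt0// => /(_ isT).
have : (M ^+ 2)^-1 * l2norm (x zeta) ^+ 2 <= l2norm zeta ^+ 2.
  rewrite ler_pdivrMl ?exprn_gt0// -exprMn ler_pXn2r// nnegrE ?l2norm_ge0//.
  by rewrite mulr_ge0 ?l2norm_ge0// ltW.
rewrite invrK exprMn; lra.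
Qed.

Lemma bopB x xi eta : x (xi - eta) = x xi - x eta.
Proof. by rewrite addrC -[- eta]scaleN1r bop_linear scaleN1r addrC. Qed.

Lemma bstar_linear x : linear (bstar x).
Proof.
move=> a xi eta; apply: l2_ext => t.
rewrite -[LHS]inner_delta bstar_adjoint innerDl innerZl -!bstar_adjoint.
by rewrite !inner_delta.
Qed.

Fact bop1_bounded : exists M : K, forall xi : H, l2norm xi <= M * l2norm xi.
Proof. by exists 1 => xi; rewrite mul1r. Qed.

Definition bop1 : bop :=
  @Bop id id (fun _ _ _ => erefl) bop1_bounded (fun _ _ => erefl).

Fact bmul_bounded x y :
  exists M : K, forall xi, l2norm (x (y xi)) <= M * l2norm xi.
Proof.
have [M M0 xM] := bop_bounded_gt0 x; have [N yN] := bop_bounded y.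
exists (M * N) => xi; apply: le_trans (xM _) _.
by rewrite -mulrA ler_wpM2l// ltW.
Qed.

Fact bmul_linear x y : linear (bfun x \o bfun y).
Proof. by move=> a xi eta /=; rewrite !bop_linear. Qed.

Fact bmul_adjoint x y xi eta :
  inner (x (y xi)) eta = inner xi (bstar y (bstar x eta)).
Proof. by rewrite !bop_adjoint. Qed.

Definition bmul x y : bop :=
  @Bop (bfun x \o bfun y) (bstar y \o bstar x)
    (bmul_linear x y) (bmul_bounded x y) (bmul_adjoint x y).

Fact badj_bounded x :
  exists M : K, forall xi, l2norm (bstar x xi) <= M * l2norm xi.
Proof.
by have [M M0 xM] := bop_bounded_gt0 x; exists M; exact: bstar_le.
Qed.

Definition badj x : bop :=
  Bop (bstar_linear x) (badj_bounded x) (bstar_adjoint x).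

Fact bsub_bounded x y :
  exists M : K, forall xi, l2norm (x xi - y xi) <= M * l2norm xi.
Proof.
have [M M0 xM] := bop_bounded_gt0 x; have [N N0 yN] := bop_bounded_gt0 y.
exists (2 * (M + N)) => xi.
have MN0 : 0 <= 2 * (M + N) * l2norm xi.
  by rewrite mulr_ge0 ?l2norm_ge0// mulr_ge0// addr_ge0// ltW.
rewrite -(@ler_pXn2r _ 2)// ?nnegrE ?l2norm_ge0//.
apply: le_trans (l2normD_sqr _ _) _; rewrite l2normN.
have h1 : l2norm (x xi) ^+ 2 <= (M * l2norm xi) ^+ 2.
  by rewrite ler_pXn2r// nnegrE ?mulr_ge0 ?l2norm_ge0// ltW.
have h2 : l2norm (y xi) ^+ 2 <= (N * l2norm xi) ^+ 2.
  by rewrite ler_pXn2r// nnegrE ?mulr_ge0 ?l2norm_ge0// ltW.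
have h3 : 0 <= M * N * l2norm xi ^+ 2.
  by rewrite mulr_ge0 ?sqr_ge0// mulr_ge0// ltW.
have h4 : 0 <= (M * l2norm xi) ^+ 2 + (N * l2norm xi) ^+ 2.
  by rewrite addr_ge0 ?sqr_ge0.
rewrite (_ : (2 * _ * _) ^+ 2 = 4 * ((M * l2norm xi) ^+ 2 + (N * l2norm xi) ^+ 2)
  + 8 * (M * N * l2norm xi ^+ 2)); last by ring.
lra.
Qed.

Fact bsub_linear x y : linear (fun xi => x xi - y xi).
Proof. by move=> a xi eta; rewrite !bop_linear scalerBr opprD addrACA. Qed.

Fact bsub_adjoint x y xi eta :
  inner (x xi - y xi) eta = inner xi (bstar x eta - bstar y eta).
Proof. by rewrite innerBl innerBr !bop_adjoint. Qed.

Definition bsub x y : bop :=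
  @Bop (fun xi => x xi - y xi) (fun xi => bstar x xi - bstar y xi)
    (bsub_linear x y) (bsub_bounded x y) (bsub_adjoint x y).

Definition commutant (S : set bop) : set bop :=
  [set x | forall y, S y -> bmul x y = bmul y x].

End Bounded.

Section GroupVN.
Variables (K : realType) (Gam : groupType).
Local Notation H := (l2 K Gam).
Local Notation B := (bop K Gam).

Lemma mulg_bij (g : Gam) : bijective (fun t => g * t)%g.
Proof.
by exists (fun t => g^-1 * t)%g => t; rewrite mulgA ?mulVg ?mulgV mul1g.
Qed.

Fact lshift_subproof (g : Gam) (xi : H) :
  (fun t => xi (g^-1 * t)%g) \in @l2_pred K Gam.
Proof.
by apply/asboolP; exact: (rsummable_bij (mulg_bij g^-1%g) (l2P xi)).
Qed.
Definition lshift g xi : H := L2 (lshift_subproof g xi).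

Lemma lshift_norm g xi : l2norm (lshift g xi) = l2norm xi.
Proof.
by congr Num.sqrt; exact: (rsum_bij (fun t => normc (xi t) ^+ 2) (mulg_bij _)).
Qed.

Lemma lshift_inner g xi eta :
  inner (lshift g xi) eta = inner xi (lshift g^-1%g eta).
Proof.
rewrite /inner /csum; congr Complex; rewrite -[LHS](rsum_bij _ (mulg_bij g));
  congr rsum; apply/funext => t /=; by rewrite mulKg invgK.
Qed.

Fact lshift_linear g : linear (lshift g).
Proof. by move=> a xi eta; exact: l2_ext. Qed.

Fact lshift_bounded g :
  exists M : K, forall xi, l2norm (lshift g xi) <= M * l2norm xi.
Proof. by exists 1 => xi; rewrite lshift_norm mul1r. Qed.

Definition lreg (g : Gam) : B :=
  Bop (lshift_linear g) (lshift_bounded g) (lshift_inner g).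

Definition group_vN : set B := commutant (commutant (range lreg)).

Definition tau (x : B) : K[i] := inner (x (delta 1%g)) (delta 1%g).

Definition norm2 (x : B) : K :=
  Num.sqrt (complex.Re (tau (bmul (badj x) x))).

Lemma norm2E x : norm2 x = l2norm (x (delta 1%g)).
Proof.
rewrite /norm2; have -> : tau (bmul (badj x) x) =
  inner (bstar x (x (delta 1%g))) (delta 1%g) by [].
by rewrite bstar_adjoint inner_norm sqrtr_sqr ger0_norm// l2norm_ge0.
Qed.

Lemma mulgr_bij (g : Gam) : bijective (fun t => t * g)%g.
Proof.
by exists (fun t => t * g^-1)%g => t; rewrite -mulgA ?mulVg ?mulgV mulg1.
Qed.

Fact rshift_subproof (g : Gam) (xi : H) :
  (fun t => xi (t * g)%g) \in @l2_pred K Gam.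
Proof.
by apply/asboolP; exact: (rsummable_bij (mulgr_bij g) (l2P xi)).
Qed.
Definition rshift g xi : H := L2 (rshift_subproof g xi).

Lemma rshift_inner g xi eta :
  inner (rshift g xi) eta = inner xi (rshift g^-1%g eta).
Proof.
rewrite /inner /csum; congr Complex;
  rewrite -[LHS](rsum_bij _ (mulgr_bij g^-1%g));
  congr rsum; apply/funext => t /=; by rewrite -mulgA mulVg mulg1.
Qed.

Fact rshift_linear g : linear (rshift g).
Proof. by move=> a xi eta; exact: l2_ext. Qed.

Fact rshift_bounded g :
  exists M : K, forall xi, l2norm (rshift g xi) <= M * l2norm xi.
Proof.
exists 1 => xi; rewrite mul1r le_eqVlt; apply/orP; left; apply/eqP.
by congr Num.sqrt; exact: (rsum_bij (fun t => normc (xi t) ^+ 2) (mulgr_bij _)).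
Qed.

Definition rreg (g : Gam) : B :=
  Bop (rshift_linear g) (rshift_bounded g) (rshift_inner g).

Lemma group_vN_rreg x g : group_vN x -> bmul x (rreg g) = bmul (rreg g) x.
Proof.
apply => _ [h _ <-]; apply: bop_ext => xi; apply: l2_ext => t /=.
by rewrite mulgA.
Qed.

(* By polarisation, this says that tau is a trace on group_vN. *)
Lemma norm2_adj x : group_vN x -> norm2 (badj x) = norm2 x.
Proof.
move=> vx; rewrite !norm2E /l2norm; congr Num.sqrt.
have invb : bijective (fun t : Gam => t^-1)%g.
  by exists (fun t => t^-1)%g => t; rewrite invgK.
rewrite -[RHS](rsum_bij _ invb); congr rsum; apply/funext => t /=.
have -> : bstar x (delta 1%g) t = conjc (x (delta 1%g) t^-1%g).
  rewrite bstarE inner_delta.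
  have -> : delta t = rreg t^-1%g (delta 1%g).
    apply: l2_ext => s /=; congr (_%:R); congr nat_of_bool.
    by apply/eqP/eqP => [->|/(congr1 (fun u => u * t)%g)];
      rewrite ?mulgV// -mulgA mulVg mulg1 mul1g.
  have /(congr1 (fun y : B => y (delta 1%g))) /= -> := group_vN_rreg t^-1%g vx.
  by rewrite /= mul1g.
by rewrite !sqr_normcE; case: (x _ _) => a b /=; rewrite sqrrN.
Qed.

Lemma group_vN_mul x y : group_vN x -> group_vN y -> group_vN (bmul x y).
Proof.
move=> vx vy z cz; apply: bop_ext => xi /=.
have /(congr1 (fun u : B => u xi)) /= e1 := vy _ cz.
have /(congr1 (fun u : B => u (y xi))) /= e2 := vx _ cz.
by rewrite e1 e2.
Qed.

Lemma group_vN1 : group_vN (bop1 K Gam).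
Proof. by move=> z _; apply: bop_ext. Qed.

Lemma bmulA : associative (@bmul K Gam). Proof. by move=> x y z; exact: bop_ext. Qed.

Lemma badjK : involutive (@badj K Gam). Proof. by move=> x; exact: bop_ext. Qed.

Lemma badjM x y : badj (@bmul K Gam x y) = bmul (badj y) (badj x).
Proof. exact: bop_ext. Qed.

Lemma badj_lreg g : badj (lreg g) = lreg g^-1%g. Proof. exact: bop_ext. Qed.

Lemma group_vN_adj x : group_vN x -> group_vN (badj x).
Proof.
have adj_comm (S : set B) : (forall y, S y -> S (badj y)) ->
    forall y, commutant S y -> commutant S (badj y).
  move=> SS y cy z Sz; rewrite -[z in LHS]badjK -[z in RHS]badjK -!badjM.
  by rewrite cy//; exact: SS.
apply: (adj_comm); apply: (adj_comm) => _ [g _ <-].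
by rewrite badj_lreg; exists g^-1%g.
Qed.

End GroupVN.

(* A permutation of nat that moves finitely many points, with its inverse. *)
Definition finperm_pred : {pred (nat -> nat) * (nat -> nat)} := fun s =>
  `[< [/\ cancel s.1 s.2, cancel s.2 s.1 &
        exists n, forall m, (n <= m)%N -> s.1 m = m] >].

Record finperm := FinPerm {
  finperm_val : (nat -> nat) * (nat -> nat);
  _ : finperm_val \in finperm_pred }.

HB.instance Definition _ := [isSub for finperm_val].
HB.instance Definition _ := [Choice of finperm by <:].

Fact finperm1_subproof : (id, id) \in finperm_pred.
Proof. by apply/asboolP; split => //; exists 0%N. Qed.
Definition finperm1 := FinPerm finperm1_subproof.

Fact finpermV_subproof (s : finperm) :
  ((val s).2, (val s).1) \in finperm_pred.
Proof.
case: s => -[f g] /= /asboolP/= [fg gf [n fn]]; apply/asboolP; split => //=.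
by exists n => m nm; rewrite -{1}(fn m nm) fg.
Qed.
Definition finpermV s := FinPerm (finpermV_subproof s).

Fact finpermM_subproof (s t : finperm) :
  ((val s).1 \o (val t).1, (val t).2 \o (val s).2) \in finperm_pred.
Proof.
case: s t => -[f g] /= /asboolP/= [fg gf [n fn]].
move=> -[[f' g'] /= /asboolP/= [fg' gf' [n' fn']]]; apply/asboolP; split => /=.
- by move=> m /=; rewrite fg fg'.
- by move=> m /=; rewrite gf' gf.
- by exists (maxn n n') => m; rewrite geq_max => /andP[nm nm'] /=; rewrite fn' ?fn.
Qed.
Definition finpermM s t := FinPerm (finpermM_subproof s t).

Fact finpermA : associative finpermM. Proof. by move=> s t u; exact: val_inj. Qed.
Fact finperm_mul1 : left_id finperm1 finpermM.
Proof. by move=> -[[f g] /= h]; exact: val_inj. Qed.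
Fact finperm_mulr1 : right_id finperm1 finpermM.
Proof. by move=> -[[f g] /= h]; exact: val_inj. Qed.
Fact finperm_mulV : left_inverse finperm1 finpermV finpermM.
Proof.
move=> -[[f g] /= h]; apply: val_inj => /=; move/asboolP: h => /= [fg gf _].
by congr pair; apply/funext => m /=; rewrite fg.
Qed.
Fact finperm_mulrV : right_inverse finperm1 finpermV finpermM.
Proof.
move=> -[[f g] /= h]; apply: val_inj => /=; move/asboolP: h => /= [fg gf _].
by congr pair; apply/funext => m /=; rewrite gf.
Qed.

HB.instance Definition _ := isGroup.Build finperm finpermA finperm_mul1
  finperm_mulr1 finperm_mulV finperm_mulrV.

(* The hyperfinite II_1 factor R, in its standard realisation as the von
   Neumann algebra of the group of finitely supported permutations of nat.
   This group is ICC, so R is a II_1 factor with trace tau and 2-norm norm2,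
   and locally finite, so R is hyperfinite. By Murray and von Neumann, every
   hyperfinite II_1 factor is isomorphic to R by an isomorphism which, the
   trace being unique, preserves the trace. *)
Definition hyperfinite (K : realType) : set (bop K finperm) :=
  @group_vN K finperm.
Arguments hyperfinite K : clear implicits.

Record free_ultrafilter := FreeUltrafilter {
  uf_sets :> set_system nat;
  uf_ultra : UltraFilter uf_sets;
  uf_free : forall n, ~ uf_sets [set n] }.

Section Ultrapower.
Variables (K : realType) (rho : free_ultrafilter).
Local Notation B := (bop K finperm).

(* l^infty(nat, R), for the operator norm *)
Record linf := Linf {
  lseq :> nat -> B;
  linf_in : forall n, hyperfinite K (lseq n);
  linf_bounded : exists M : K, forall n xi, l2norm (lseq n xi) <= M * l2norm xi }.

HB.instance Definition _ := gen_eqMixin linf.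
HB.instance Definition _ := gen_choiceMixin linf.

Implicit Types x y z : linf.

Lemma linf_bounded_gt0 x :
  exists2 M : K, 0 < M & forall n xi, l2norm (x n xi) <= M * l2norm xi.
Proof.
have [M xM] := linf_bounded x; exists (`|M| + 1); first by rewrite ltr_wpDl.
move=> n xi; apply: le_trans (xM n xi) _; rewrite ler_wpM2r ?l2norm_ge0//.
by rewrite (le_trans (ler_norm M))// lerDl.
Qed.

Fact linf1_bounded : exists M : K, forall (n : nat) xi,
  l2norm (bop1 K finperm xi) <= M * l2norm xi.
Proof. by exists 1 => n xi /=; rewrite mul1r. Qed.

Definition linf1 : linf :=
  @Linf (fun=> bop1 K finperm) (fun=> @group_vN1 K finperm) linf1_bounded.

Fact lmul_in x y n : hyperfinite K (bmul (x n) (y n)).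
Proof. by apply: group_vN_mul; exact: linf_in. Qed.

Fact lmul_bounded x y : exists M : K, forall n xi,
  l2norm (bmul (x n) (y n) xi) <= M * l2norm xi.
Proof.
have [M M0 xM] := linf_bounded_gt0 x.
have [N yN] := linf_bounded y; exists (M * N) => n xi /=.
by apply: le_trans (xM n _) _; rewrite -mulrA ler_wpM2l// ltW.
Qed.

Definition lmul x y : linf := Linf (lmul_in x y) (lmul_bounded x y).

Fact ladj_in x n : hyperfinite K (badj (x n)).
Proof. by apply: group_vN_adj; exact: linf_in. Qed.

Fact ladj_bounded x : exists M : K, forall n xi,
  l2norm (badj (x n) xi) <= M * l2norm xi.
Proof.
have [M M0 xM] := linf_bounded_gt0 x.
by exists M => n xi /=; exact: bstar_le.
Qed.

Definition ladj x : linf := Linf (ladj_in x) (ladj_bounded x).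

Definition null_eq x y : bool :=
  `[< norm2 (bsub (x n) (y n)) @[n --> (rho : set_system nat)] --> (0 : K) >].

Local Instance rho_ultra : UltraFilter rho := uf_ultra rho.
Local Instance rho_filter : ProperFilter rho := ultra_proper.

Lemma norm2_ge0 (u : B) : 0 <= norm2 u. Proof. exact: sqrtr_ge0. Qed.

Lemma rho_squeeze (C D : K) (f g h : nat -> K) :
  (forall n, 0 <= f n <= C * g n + D * h n) ->
  g n @[n --> (rho : set_system nat)] --> (0 : K) ->
  h n @[n --> (rho : set_system nat)] --> (0 : K) ->
  f n @[n --> (rho : set_system nat)] --> (0 : K).
Proof.
move=> fgh g0 h0; apply: (@squeeze_cvgr _ _ _ _ (fun=> 0) (fun n => C * g n + D * h n)).
- by apply: nearW.
- exact: cvg_cst.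
- have -> : (0 : K) = C * 0 + D * 0 by rewrite !mulr0 addr0.
  by apply: cvgD; apply: cvgM => //; exact: cvg_cst.
Qed.

Lemma norm2_triangle (u v w : B) :
  norm2 (bsub u w) <= 2 * norm2 (bsub u v) + 2 * norm2 (bsub v w).
Proof.
rewrite !norm2E /=; set a := u _; set b := v _; set c := w _.
by have := l2normD2 (a - b) (b - c); rewrite addrA subrK.
Qed.

Lemma norm2_subC (u v : B) : norm2 (bsub u v) = norm2 (bsub v u).
Proof. by rewrite !norm2E /= -[in RHS]l2normN opprB. Qed.

Lemma null_eq_refl : reflexive null_eq.
Proof.
move=> x; apply/asboolP.
rewrite (_ : (fun n => _) = fun=> 0); first exact: cvg_cst.
by apply/funext => n; rewrite norm2E /= subrr l2norm0.
Qed.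

Lemma null_eq_sym : symmetric null_eq.
Proof.
move=> x y; rewrite /null_eq.
by under eq_fun do rewrite norm2_subC.
Qed.

Lemma null_eq_trans : transitive null_eq.
Proof.
move=> y x z /asboolP xy /asboolP yz; apply/asboolP.
apply: (rho_squeeze (C := 2) (D := 2) _ xy yz) => n.
by rewrite norm2_ge0 norm2_triangle.
Qed.

Canonical null_eq_equiv :=
  EquivRel null_eq null_eq_refl null_eq_sym null_eq_trans.

(* The tracial ultrapower R^rho. Its operations are induced by those of linf:
   see pi_umul, pi_uadj, pi_utrace and tau_cvg. *)
Definition ultrapower := {eq_quot null_eq}%qT.

Definition umul : ultrapower -> ultrapower -> ultrapower :=
  lift_op2 ultrapower lmul.
Definition uadj : ultrapower -> ultrapower := lift_op1 ultrapower ladj.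
Definition uone : ultrapower := lift_cst ultrapower linf1.
Definition utrace : ultrapower -> K[i] :=
  lift_fun1 ultrapower (fun x =>
    lim ((tau (x n) : K[i]^o) @[n --> (rho : set_system nat)])).

Lemma null_eqP x y : reflect (\pi_ultrapower x = \pi_ultrapower y)%qT (null_eq x y).
Proof. by rewrite -[null_eq x y]eqmodE; exact: eqP. Qed.

Lemma null_eq_repr x : null_eq (repr (\pi_ultrapower x)%qT) x.
Proof. by apply/null_eqP; rewrite reprK. Qed.

Lemma norm2_mull (u v : B) (M : K) :
  (forall xi, l2norm (u xi) <= M * l2norm xi) -> norm2 (bmul u v) <= M * norm2 v.
Proof. by move=> uM; rewrite !norm2E /=. Qed.

Lemma norm2_mulr (u v : B) (M : K) : 0 < M ->
  hyperfinite K u -> hyperfinite K v ->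
  (forall xi, l2norm (v xi) <= M * l2norm xi) -> norm2 (bmul u v) <= M * norm2 u.
Proof.
move=> M0 hu hv vM; rewrite -norm2_adj; last exact: group_vN_mul.
by rewrite badjM -[norm2 u]norm2_adj//; apply: norm2_mull; exact: bstar_le.
Qed.

Lemma hyperfinite_sub (u v : B) :
  hyperfinite K u -> hyperfinite K v -> hyperfinite K (bsub u v).
Proof.
move=> hu hv z cz; apply: bop_ext => xi /=.
have /(congr1 (fun w : B => w xi)) /= -> := hu _ cz.
have /(congr1 (fun w : B => w xi)) /= -> := hv _ cz.
by rewrite bopB.
Qed.

Lemma pi_umul x y :
  umul (\pi_ultrapower x)%qT (\pi_ultrapower y)%qT = (\pi_ultrapower (lmul x y))%qT.
Proof.
unlock umul; apply/null_eqP.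
set x' := repr _; set y' := repr _.
have /asboolP xx' := null_eq_repr x; have /asboolP yy' := null_eq_repr y.
have [M M0 xM] := linf_bounded_gt0 x'; have [N N0 yN] := linf_bounded_gt0 y.
apply/asboolP; apply: (rho_squeeze (C := 2 * M) (D := 2 * N) _ yy' xx') => n.
rewrite norm2_ge0 /=; apply: le_trans (norm2_triangle _ (bmul (x' n) (y n)) _) _.
rewrite -!mulrA lerD// ler_pM2l//.
- rewrite [X in norm2 X](_ : _ = bmul (x' n) (bsub (y' n) (y n))).
    exact: norm2_mull.
  by apply: bop_ext => xi /=; rewrite bopB.
- rewrite [X in norm2 X](_ : _ = bmul (bsub (x' n) (x n)) (y n)).
    by apply: norm2_mulr => //; [apply: hyperfinite_sub|]; exact: linf_in.
  exact: bop_ext.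
Qed.

Lemma pi_uone : uone = (\pi_ultrapower linf1)%qT.
Proof. by unlock uone. Qed.

Lemma pi_uadj x : uadj (\pi_ultrapower x)%qT = (\pi_ultrapower (ladj x))%qT.
Proof.
unlock uadj; apply/null_eqP.
have /asboolP := null_eq_repr x; set x' := repr _ => xx'; apply/asboolP.
rewrite (_ : (fun n => _) = fun n => norm2 (bsub (x' n) (x n)))//.
apply/funext => n; rewrite -norm2_adj; last by apply: hyperfinite_sub; exact: linf_in.
by congr norm2; exact: bop_ext.
Qed.

Lemma rho_cvgR (f : nat -> K) (M : K) : (forall n, `|f n| <= M) ->
  exists l : K, f n @[n --> (rho : set_system nat)] --> l.
Proof.
move=> fM; pose F := f n @[n --> (rho : set_system nat)].
have FA : F [set` `[- M, M]].
  rewrite (_ : F _ = uf_sets rho (f @^-1` [set` `[- M, M]]))//.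
  by apply: filterE => n; rewrite /preimage /= in_itv /= -ler_norml.
have [l [_ lF]] := @segment_compact _ (- M) M F (fmap_proper_filter f _) FA.
exists l => U lU; case: (in_ultra_setVsetC (f @^-1` U) (uf_ultra rho)) => // FU.
by have [y [nUy Uy]] := lF (~` U) U FU lU.
Qed.

Lemma rho_cvgC (f : nat -> K[i]) (l : K[i]) :
  complex.Re (f n) @[n --> (rho : set_system nat)] --> complex.Re l ->
  complex.Im (f n) @[n --> (rho : set_system nat)] --> complex.Im l ->
  (f n : K[i]^o) @[n --> (rho : set_system nat)] --> (l : K[i]^o).
Proof.
move=> fR fI; apply/cvgrPdist_lt => -[e e'] /=.
rewrite ltcE /= => /andP[/eqP -> e0].
have e20 : 0 < e / 2 by rewrite divr_gt0.
move/cvgrPdist_lt: fR => /(_ _ e20) fR; move/cvgrPdist_lt: fI => /(_ _ e20) fI.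
apply: filterS2 fR fI => n /=; case: (f n) l => [a b] [c d] /= ha hb.
rewrite normc_def ltcR /= -(@ltr_pXn2r _ 2)// ?nnegrE ?sqrtr_ge0 ?(ltW e0)//.
rewrite sqr_sqrtr ?addr_ge0 ?sqr_ge0// -[(c - a) ^+ 2]real_normK ?num_real//.
rewrite -[(d - b) ^+ 2]real_normK ?num_real//.
have h1 : `|c - a| ^+ 2 < (e / 2) ^+ 2 by rewrite ltr_pXn2r// nnegrE// ltW.
have h2 : `|d - b| ^+ 2 < (e / 2) ^+ 2 by rewrite ltr_pXn2r// nnegrE// ltW.
have h3 : 0 <= e ^+ 2 by rewrite sqr_ge0.
have h4 : (e / 2) ^+ 2 = e ^+ 2 / 4 by field.
by rewrite h4 in h1 h2; lra.
Qed.

Lemma norm_Re_Im_le (z : K[i]) :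
  `|complex.Re z| <= normc z /\ `|complex.Im z| <= normc z.
Proof.
case: z => a b /=; split; rewrite -sqrtr_sqr ler_sqrt ?addr_ge0 ?sqr_ge0//.
- by rewrite lerDl sqr_ge0.
- by rewrite lerDr sqr_ge0.
Qed.

Lemma tau_le (u : B) : normc (tau u) <= norm2 u.
Proof. by rewrite norm2E /tau inner_delta; exact: le_l2norm. Qed.

Lemma tau_cvg x : exists l : K[i],
  (tau (x n) : K[i]^o) @[n --> (rho : set_system nat)] --> (l : K[i]^o).
Proof.
have [M M0 xM] := linf_bounded_gt0 x; pose C := M * l2norm (delta 1%g : l2 K finperm).
have tC n : normc (tau (x n)) <= C by apply: le_trans (tau_le _) _; rewrite norm2E.
have [a ha] : exists a : K,
    complex.Re (tau (x n)) @[n --> (rho : set_system nat)] --> a.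
  by apply: (rho_cvgR (M := C)) => n; apply: le_trans (tC n);
    have [] := norm_Re_Im_le (tau (x n)).
have [b hb] : exists b : K,
    complex.Im (tau (x n)) @[n --> (rho : set_system nat)] --> b.
  by apply: (rho_cvgR (M := C)) => n; apply: le_trans (tC n);
    have [] := norm_Re_Im_le (tau (x n)).
by exists (Complex a b); exact: rho_cvgC.
Qed.

Lemma pi_utrace x l :
  (tau (x n) : K[i]^o) @[n --> (rho : set_system nat)] --> (l : K[i]^o) ->
  utrace (\pi_ultrapower x)%qT = l.
Proof.
move=> xl; unlock utrace; apply: (@cvg_lim K[i]^o); first exact: norm_hausdorff.
have /asboolP := null_eq_repr x; set x' := repr _ => xx'.
have d0 : (tau (x' n) - tau (x n) : K[i]^o) @[n --> (rho : set_system nat)]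
    --> (0 : K[i]^o).
  have le n : normc (tau (x' n) - tau (x n)) <= norm2 (bsub (x' n) (x n)).
    apply: le_trans (tau_le _).
    by rewrite /tau !inner_delta.
  have small (f : nat -> K) : (forall n, `|f n| <= norm2 (bsub (x' n) (x n))) ->
      f n @[n --> (rho : set_system nat)] --> (0 : K).
    move=> fle; apply/cvgrPdist_lt => e e0; move/cvgrPdist_lt: xx' => /(_ e e0).
    apply: filterS => n /=; rewrite !sub0r !normrN [X in X < _]ger0_norm ?norm2_ge0//.
    exact: le_lt_trans.
  by apply: rho_cvgC; apply: small => n; apply: le_trans (le n);
    have [] := norm_Re_Im_le (tau (x' n) - tau (x n)).
have e : (fun n => tau (x' n)) =
    (fun n => (tau (x' n) - tau (x n)) + tau (x n)) :> (nat -> K[i]^o).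
  by apply/funext => n; rewrite subrK.
by rewrite e -[l]add0r; exact: (cvgD d0 xl).
Qed.

Definition unitary (u : ultrapower) : Prop :=
  umul (uadj u) u = uone /\ umul u (uadj u) = uone.

End Ultrapower.

Section Hyperlinear.
Variables (K : realType) (G : groupType).

Definition positive_definite (phi : G -> K[i]) : Prop :=
  forall (n : nat) (g : 'I_n -> G) (c : 'I_n -> K[i]),
    0 <= \sum_(i < n) \sum_(j < n)
           conjc (c i) * c j * phi ((g i)^-1 * g j)%g.

Definition central_pair (phi : G -> K[i]) : Prop :=
  [/\ positive_definite phi,
      forall g h : G, phi (h^-1 * g * h)%g = phi g &
      phi 1%g = 1].

Definition hyperlinear_pair (phi : G -> K[i]) : Prop :=
  central_pair phi /\
  exists (rho : free_ultrafilter) (theta : G -> ultrapower K rho),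
    [/\ forall g, unitary (theta g),
        forall g h, theta (g * h)%g = umul (theta g) (theta h) &
        forall g, utrace (theta g) = phi g].

Definition delta_e : G -> K[i] := fun g => (g == 1%g)%:R.

Definition hyperlinear : Prop := hyperlinear_pair delta_e.

End Hyperlinear.

(* Main.v *)
Require Import Defs.
From mathcomp Require Import all_boot all_order all_algebra.
From mathcomp Require Import all_classical all_reals all_analysis.
From mathcomp Require Import complex ring lra.
Set Implicit Arguments.
Unset Strict Implicit.
Unset Printing Implicit Defensive.
Import Order.TTheory GRing.Theory Num.Theory.
Import numFieldNormedType.Exports.
Local Open Scope classical_set_scope.
Local Open Scope ring_scope.

(** Forward, delta_e itself separates every g <> 1 from 1. For the converse,
    products of the given characters converge pointwise to delta_e: since
    |phi_g(g)| < 1, a high power of phi_g is small at g, and since a character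
    has modulus at most 1, the product of such powers over a finite set F is
    small at every nontrivial element of F, while it stays 1 at the identity.
    It has to be shown that products and pointwise limits of hyperlinear
    characters are again hyperlinear. The given pairs come with unrelated
    ultrafilters, so the argument passes through finitary approximations.

    A function phi is called approximable below if, for every finite set F and
    every e > 0, there are contractions u g in R that are, in the 2-norm and
    for g in F, multiplicative and unitary up to e and satisfy
    |tau (u g) - phi g| < e.

    A hyperlinear pair is approximable (hyperlinear_pair_approximable). The
    point is to represent a unitary of the ultrapower by a sequence of
    contractions (contraction_lift). A Newton iteration for the polar
    decomposition, x |-> x (1 + c - c x* x), does not change the class of x
    and divides the bound on ||x||^2 by 4 as long as that bound is at least 4.

    Approximability is stable under products (approximableM), because R
    contains a copy of its tensor square: the permutations of the even and of
    the odd numbers form two commuting copies of the finitely supported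
    permutation group Gam, meeting trivially. An injective homomorphism
    Gam -> Gam induces a trace-preserving embedding amp of the group von
    Neumann algebra into itself, which lets an operator act on each right coset
    of the image separately; then tens u v = amp u * amp v has trace
    tau u * tau v and depends on u and v in a Lipschitz way for the 2-norm.
    Approximability is stable under pointwise limits by definition, so delta_e
    is approximable (approximable_delta_e).

    Finally, for countable G an approximable central pair is hyperlinear
    (approximable_hyperlinear_pair): the approximations for an exhaustion of G
    by finite sets, with e = 1/(n+1), form the n-th coordinates of a
    representation in the ultrapower along any free ultrafilter. *)

(** * Square-summable functions *)

Section L2.
Variables (K : realType) (T : choiceType).
Implicit Types xi eta : l2 K T.

Lemma normc_ge0 (a : K[i]) : 0 <= normc a.
Proof. by case: a => a b; exact: sqrtr_ge0. Qed.

Lemma l2normZ (a : K[i]) xi : l2norm (a *: xi) = normc a * l2norm xi.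
Proof.
apply/eqP; rewrite -(@eqrXn2 _ 2)// ?mulr_ge0 ?l2norm_ge0 ?normc_ge0//.
rewrite exprMn !l2_sumE -rsumZ; last exact: l2P.
by apply/eqP; congr rsum; apply/funext => t;
  rewrite l2Z ComplexField.Normc.normcM exprMn.
Qed.

(** Matrix coefficients determine the adjoint on every vector, by
    [bstarE], hence the operator. *)
Lemma inner_delta_inj (x y : bop K T) :
  (forall p q, inner (x (delta p)) (delta q) = inner (y (delta p)) (delta q)) ->
  x = y.
Proof.
move=> xy; apply: bop_ext => xi; apply: l2_ext => t.
rewrite -!inner_delta !bop_adjoint; congr inner.
by apply: l2_ext => s; rewrite !bstarE xy.
Qed.

Lemma bop0 (x : bop K T) : x 0 = 0.
Proof. by have := bopB x 0 0; rewrite !subrr. Qed.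

Lemma bopZ (x : bop K T) (a : K[i]) xi : x (a *: xi) = a *: x xi.
Proof. by have := bop_linear x a xi 0; rewrite bop0 !addr0. Qed.

End L2.

(** * Sums over the right cosets of a subgroup *)

Section Cosets.
Variables (K : realType) (L Gam : groupType) (iota : L -> Gam).
Hypothesis iotaM : forall s t, iota (s * t)%g = (iota s * iota t)%g.
Hypothesis iota_inj : injective iota.

Lemma iota1 : iota 1%g = 1%g.
Proof. by apply: (mulgI (iota 1%g)); rewrite -iotaM !mulg1. Qed.

Lemma iotaV s : iota s^-1%g = (iota s)^-1%g.
Proof. by apply: (mulgI (iota s)); rewrite -iotaM !mulgV iota1. Qed.

(* The chosen representative depends only on the coset, as a set. *)
Let coset_rep (t : Gam) : Gam := xget 1%g [set c | exists s, t = (iota s * c)%g].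

Let coset_repP t : exists s, t = (iota s * coset_rep t)%g.
Proof.
by rewrite /coset_rep; case: xgetP => // /(_ t); case; exists 1%g; rewrite iota1 mul1g.
Qed.

Let coset_repM s t : coset_rep (iota s * t)%g = coset_rep t.
Proof.
rewrite /coset_rep; congr xget; apply/seteqP; split => c /= [r e].
- by exists (s^-1 * r)%g; rewrite iotaM iotaV -mulgA -e mulKg.
- by exists (s * r)%g; rewrite iotaM -mulgA -e.
Qed.

Lemma esum_cosets (f : Gam -> \bar K) : (forall t, 0 <= f t)%E ->
  \esum_(t in [set: Gam]) f t =
  \esum_(c in range coset_rep) \esum_(s in [set: L]) f (iota s * c)%g.
Proof.
move=> f0; rewrite esum_esum//.
apply: (reindex_esum _ _ (fun k => iota k.2 * k.1)%g); split => //.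
- move=> [c s] [c' s']; rewrite !inE /= => -[[t _ <-] _] [[t' _ <-] _] /= e.
  have repK u : coset_rep (coset_rep u) = coset_rep u.
    by have [r {2}->] := coset_repP u; rewrite coset_repM.
  have ee : coset_rep t = coset_rep t'.
    by have := congr1 coset_rep e; rewrite !coset_repM !repK.
  by move: e; rewrite ee => /mulIg/iota_inj ->.
- move=> t _; have [s e] := coset_repP t.
  by exists (coset_rep t, s) => //=; split => //; exists t.
Qed.

Lemma ge0_rsum_cosets (f g : Gam -> K) :
  (forall t, 0 <= f t) -> (forall t, 0 <= g t) -> rsummable g ->
  (forall c, \esum_(s in [set: L]) (f (iota s * c)%g)%:E <=
             \esum_(s in [set: L]) (g (iota s * c)%g)%:E)%E ->
  rsummable f /\ rsum f <= rsum g.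
Proof.
move=> f0 g0 sg fg.
have le : (\esum_(t in [set: Gam]) (f t)%:E <= \esum_(t in [set: Gam]) (g t)%:E)%E.
  by rewrite !esum_cosets; [apply: le_esum => c _; exact: fg|move=> t; rewrite lee_fin..].
have gfin := (ge0_rsummableE g0).1 sg; have ffin := le_lt_trans le gfin.
have sf : rsummable f := (ge0_rsummableE f0).2 ffin.
have fin (u : Gam -> K) : (forall t, 0 <= u t) ->
    (\esum_(t in [set: Gam]) (u t)%:E < +oo)%E ->
    \esum_(t in [set: Gam]) (u t)%:E \is a fin_num.
  by move=> u0 h; rewrite ge0_fin_numE//; apply: esum_ge0 => t _; rewrite lee_fin.
by split=> //; rewrite !rsum_ge0E// fine_le// fin.
Qed.

Lemma rsummable_coset (f : Gam -> K) c : rsummable f ->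
  rsummable (fun s => f (iota s * c)%g).
Proof.
apply: le_lt_trans => /=.
rewrite -(esum_image _ (fun s => iota s * c)%g (fun t => `|f t|%:E)); last first.
  by move=> s t _ _ /mulIg/iota_inj.
rewrite esum_mkcond; apply: le_esum => t _; case: ifP => // _.
Qed.

(** Splitting both functions into positive and negative parts and moving the
    negative parts across the inequality leaves sums of nonnegative terms. *)
Lemma ler_rsum_cosets (f g : Gam -> K) : rsummable f -> rsummable g ->
  (forall c, rsum (fun s => f (iota s * c)%g) <= rsum (fun s => g (iota s * c)%g)) ->
  rsum f <= rsum g.
Proof.
move=> /rsum_pos_neg[p [q [p0 q0 sp sq ->]]].
move=> /rsum_pos_neg[p' [q' [p'0 q'0 sp' sq' ->]]] h.
rewrite !rsumB_ge0// -!rsum_ge0E// lerBlDr addrAC lerBrDr -!rsumD_ge0//.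
apply: (ge0_rsum_cosets _ _ _ _).2.
- by move=> t; rewrite addr_ge0.
- by move=> t; rewrite addr_ge0.
- exact: rsummableD.
move=> c; have sc (u : Gam -> K) : rsummable u -> _ := @rsummable_coset u c.
have {}h := h c; move: h; rewrite !rsumB_ge0; try (exact: sc); try by [].
rewrite -!rsum_ge0E; try (exact: sc); try by [].
rewrite lerBlDr addrAC lerBrDr -!rsumD_ge0; try (exact: sc); try by [].
have fin (u v : Gam -> K) : (forall t, 0 <= u t) -> (forall t, 0 <= v t) ->
   rsummable u -> rsummable v ->
   ((rsum (fun s => u (iota s * c)%g + v (iota s * c)%g))%:E =
   \esum_(s in [set: L]) (u (iota s * c)%g + v (iota s * c)%g)%:E)%E.
  move=> u0 v0 su sv; have s0 s : 0 <= u (iota s * c)%g + v (iota s * c)%g.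
    by rewrite addr_ge0.
  rewrite rsum_ge0E//; last exact: rsummableD (sc u su) (sc v sv).
  rewrite fineK// ge0_fin_numE; last by apply: esum_ge0 => s _; rewrite lee_fin.
  exact/(ge0_rsummableE s0).1/(rsummableD (sc u su) (sc v sv)).
by move=> le; rewrite -!fin// lee_fin.
Qed.

Lemma eq_rsum_cosets (f g : Gam -> K) : rsummable f -> rsummable g ->
  (forall c, rsum (fun s => f (iota s * c)%g) = rsum (fun s => g (iota s * c)%g)) ->
  rsum f = rsum g.
Proof.
by move=> sf sg fg; apply/eqP; rewrite eq_le !ler_rsum_cosets// => c; rewrite fg.
Qed.

End Cosets.

(** * Group von Neumann algebras on the canonical basis *)

Section Deltas.
Variables (K : realType) (Gam : groupType).
Implicit Types (f h : l2 K Gam).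

Lemma lshift_delta (s t : Gam) : Defs.lshift s (delta t) = delta (s * t)%g :> l2 K Gam.
Proof.
apply: l2_ext => r /=; congr (_%:R); congr nat_of_bool.
by apply/eqP/eqP => [<-|->]; rewrite ?mulVKg ?mulKg.
Qed.

Lemma rshift_delta (s t : Gam) :
  Defs.rshift s (delta t) = delta (t * s^-1)%g :> l2 K Gam.
Proof.
apply: l2_ext => r /=; congr (_%:R); congr nat_of_bool.
by apply/eqP/eqP => [<-|->]; rewrite ?mulgK ?mulgVK.
Qed.

(** Both sides are the sum of f s * h s^-1 over s: this is why operators
    built from left and from right translations commute. *)
Lemma inner_inv (f h f' h' : l2 K Gam) :
  (forall s, f' s = conjc (f s^-1%g)) -> (forall s, h' s = conjc (h s^-1%g)) ->
  inner f h' = inner h f'.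
Proof.
move=> ef eh; have invb : bijective (fun t : Gam => t^-1)%g.
  by exists (fun t => t^-1)%g => t; rewrite invgK.
by congr Complex; rewrite -[RHS](rsum_bij _ invb); congr rsum; apply/funext => s;
  rewrite ef eh invgK !conjcK mulrC.
Qed.

Lemma vN_rshift (x : bop K Gam) s f :
  group_vN x -> x (Defs.rshift s f) = Defs.rshift s (x f).
Proof. by move=> /(group_vN_rreg s)/(congr1 (fun w : bop K Gam => w f)). Qed.

Lemma vN_bstar_delta1 (x : bop K Gam) s : group_vN x ->
  bstar x (delta 1%g) s = conjc (x (delta 1%g) s^-1%g).
Proof.
move=> vx; rewrite bstarE inner_delta.
by rewrite -[s in delta s]invgK -[_^-1%g]mul1g -rshift_delta vN_rshift//= mul1g.
Qed.

End Deltas.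

(** * Amplification along an injective homomorphism *)

Section Amplification.
Variables (K : realType) (L Gam : groupType) (iota : L -> Gam).
Hypothesis iotaM : forall s t, iota (s * t)%g = (iota s * iota t)%g.
Hypothesis iota_inj : injective iota.
Implicit Types (xi eta : l2 K Gam) (zeta : l2 K L) (t : Gam) (s : L).

Fact res_subproof t xi : (fun s => xi (iota s * t)%g) \in @l2_pred K L.
Proof. by apply/asboolP; exact: (rsummable_coset iota_inj t (l2P xi)). Qed.

(** The restriction of xi to the right coset of t, transported to L. *)
Definition res t xi : l2 K L := L2 (res_subproof t xi).

Lemma res_linear t : linear (res t).
Proof. by move=> a xi eta; exact: l2_ext. Qed.

Lemma res_iota s t xi : res (iota s * t)%g xi = Defs.rshift s (res t xi).
Proof. by apply: l2_ext => r /=; rewrite iotaM mulgA. Qed.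

Section Operator.
Variables (x : bop K L) (vx : group_vN x).

(* x commutes with right translations, so evaluating x (res t xi) at 1 for
   every t in a coset lists the values of x (res c xi) for one c in it. *)
Let amp_val xi t := x (res t xi) 1%g.

Let amp_valE xi t s : amp_val xi (iota s * t)%g = x (res t xi) s.
Proof. by rewrite /amp_val res_iota vN_rshift//= mul1g. Qed.

Let amp_val_bound (M : K) xi : 0 < M ->
  (forall zeta, l2norm (x zeta) <= M * l2norm zeta) ->
  rsummable (fun t => normc (amp_val xi t) ^+ 2) /\
  rsum (fun t => normc (amp_val xi t) ^+ 2) <= M ^+ 2 * l2norm xi ^+ 2.
Proof.
move=> M0 xM; rewrite l2_sumE -rsumZ; last exact: l2P.
apply: (ge0_rsum_cosets iotaM iota_inj).
- by move=> t; rewrite sqr_ge0.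
- by move=> t; rewrite mulr_ge0 ?sqr_ge0.
- exact/rsummableZ/l2P.
move=> c; rewrite esumZ ?sqr_ge0//; last by move=> s; rewrite sqr_ge0.
rewrite (eq_esum (b := fun s => (normc (x (res c xi) s) ^+ 2)%:E)); last first.
  by move=> s _; rewrite amp_valE.
have fin (zeta : l2 K L) : \esum_(s in [set: L]) (normc (zeta s) ^+ 2)%:E =
    (l2norm zeta ^+ 2)%:E.
  have z0 s : 0 <= normc (zeta s) ^+ 2 by rewrite sqr_ge0.
  rewrite l2_sumE rsum_ge0E//; last exact: l2P.
  have := (ge0_rsummableE z0).1 (l2P zeta) => h.
  rewrite fineK// ge0_fin_numE//; apply: esum_ge0 => s _; by rewrite lee_fin.
rewrite (fin (x (res c xi))) (fin (res c xi)) -EFinM lee_fin -exprMn.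
by rewrite ler_pXn2r// nnegrE ?mulr_ge0 ?l2norm_ge0// ltW.
Qed.

Fact amp_subproof xi : amp_val xi \in @l2_pred K Gam.
Proof.
have [M M0 xM] := bop_bounded_gt0 x.
by apply/asboolP; have [] := amp_val_bound xi M0 xM.
Qed.

Definition amp_fun xi : l2 K Gam := L2 (amp_subproof xi).

Lemma res_amp_fun t xi : res t (amp_fun xi) = x (res t xi).
Proof. by apply: l2_ext => s /=; rewrite amp_valE. Qed.

Lemma amp_fun_bound (M : K) : 0 < M ->
  (forall zeta, l2norm (x zeta) <= M * l2norm zeta) ->
  forall xi, l2norm (amp_fun xi) <= M * l2norm xi.
Proof.
move=> M0 xM xi; rewrite -(@ler_pXn2r _ 2)// ?nnegrE ?mulr_ge0 ?l2norm_ge0 ?(ltW M0)//.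
by rewrite exprMn [leLHS]l2_sumE; have [] := amp_val_bound xi M0 xM.
Qed.

Fact amp_fun_linear : linear amp_fun.
Proof.
by move=> a xi eta; apply: l2_ext => t; rewrite /= /amp_val res_linear bop_linear.
Qed.

Fact amp_fun_bounded : exists M : K, forall xi, l2norm (amp_fun xi) <= M * l2norm xi.
Proof.
by have [M M0 xM] := bop_bounded_gt0 x; exists M; exact: amp_fun_bound.
Qed.

End Operator.

Lemma inner_cosets (xi eta xi' eta' : l2 K Gam) :
  (forall t, inner (res t xi) (res t eta) = inner (res t xi') (res t eta')) ->
  inner xi eta = inner xi' eta'.
Proof.
move=> h; have [sR sI] := inner_summable xi eta.
have [sR' sI'] := inner_summable xi' eta'.
by congr Complex; apply: (eq_rsum_cosets iotaM iota_inj) => // t; have [] := h t.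
Qed.

Fact amp_fun_adjoint (x : bop K L) (vx : group_vN x) xi eta :
  inner (amp_fun vx xi) eta = inner xi (amp_fun (group_vN_adj vx) eta).
Proof.
by apply: inner_cosets => t; rewrite !res_amp_fun bop_adjoint.
Qed.

Definition amp (x : bop K L) (vx : group_vN x) : bop K Gam :=
  Bop (amp_fun_linear vx) (amp_fun_bounded vx) (amp_fun_adjoint vx).

Lemma res_amp x (vx : group_vN x) t xi : res t (amp vx xi) = x (res t xi).
Proof. exact: res_amp_fun. Qed.

(** The intertwining relation [res_amp] characterises the amplification, which
    makes its algebraic properties formal. *)
Lemma amp_unique x (vx : group_vN x) (X : bop K Gam) :
  (forall t xi, res t (X xi) = x (res t xi)) -> X = amp vx.
Proof.
move=> h; apply: bop_ext => xi; apply: l2_ext => t.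
by have /(congr1 (fun z : l2 K L => z 1%g)) := h t xi; rewrite /= iota1// mul1g.
Qed.

Lemma amp_contraction x (vx : group_vN x) :
  (forall zeta, l2norm (x zeta) <= l2norm zeta) ->
  forall xi, l2norm (amp vx xi) <= l2norm xi.
Proof.
move=> x1 xi; have := amp_fun_bound vx (M := 1) ltr01 _ xi; rewrite !mul1r.
by apply => z; rewrite mul1r.
Qed.

Lemma res_delta1 : res 1%g (delta 1%g) = delta 1%g :> l2 K L.
Proof.
apply: l2_ext => s /=; congr (_%:R); congr nat_of_bool; rewrite mulg1.
by apply/eqP/eqP => [h|->]; [apply: iota_inj; rewrite h|]; rewrite iota1.
Qed.

Lemma res_delta1_out t : (forall s, (iota s * t)%g <> 1%g) ->
  res t (delta 1%g) = 0 :> l2 K L.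
Proof. by move=> h; apply: l2_ext => s /=; have /eqP/negbTE -> := h s. Qed.

(** The amplification of x lies in the bicommutant of the translations by the
    image of iota. On basis vectors, both matrix coefficients of the products
    convolve the symbol x (delta 1) of x with a coset restriction of
    z (delta p). *)
Lemma lreg_iota_comm x (vx : group_vN x) (z : bop K Gam) :
  (forall s, bmul z (lreg K (iota s)) = bmul (lreg K (iota s)) z) ->
  bmul (amp vx) z = bmul z (amp vx).
Proof.
move=> cz; apply: inner_delta_inj => p q /=.
have -> : inner (amp vx (z (delta p))) (delta q) =
    inner (res q (z (delta p))) (bstar x (delta 1%g)).
  by rewrite inner_delta /= -[LHS]inner_delta bop_adjoint.
have -> : inner (z (amp vx (delta p))) (delta q) =
    inner (x (delta 1%g)) (res p (bstar z (delta q))).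
  rewrite bop_adjoint inner_conj -bstar_adjoint inner_delta /=.
  by rewrite -[bstar x _ _]inner_delta bstar_adjoint -inner_conj.
apply: inner_inv => s; last exact: vN_bstar_delta1.
rewrite /= bstarE inner_delta -lshift_delta.
have /(congr1 (fun w : bop K Gam => w (delta p))) /= -> := cz s.
by rewrite /= iotaV.
Qed.

End Amplification.

Section AmplificationAlgebra.
Variables (K : realType) (L Gam : groupType) (iota : L -> Gam).
Hypothesis iotaM : forall s t, iota (s * t)%g = (iota s * iota t)%g.
Hypothesis iota_inj : injective iota.
Local Notation amp := (amp (K := K) iotaM iota_inj).
Implicit Types x y : bop K L.

Lemma amp_vN x (vx : group_vN x) : group_vN (amp vx).
Proof.
move=> z cz; apply: lreg_iota_comm => // s.
by apply: cz; exists (iota s).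
Qed.

Lemma amp1 (v1 : group_vN (bop1 K L)) : amp v1 = bop1 K Gam.
Proof. by apply/esym/amp_unique. Qed.

Lemma ampM x y (vx : group_vN x) (vy : group_vN y) (vxy : group_vN (bmul x y)) :
  amp vxy = bmul (amp vx) (amp vy).
Proof. by apply/esym/amp_unique => t xi; rewrite /= !res_amp_fun. Qed.

Lemma ampB x y (vx : group_vN x) (vy : group_vN y) (vxy : group_vN (bsub x y)) :
  amp vxy = bsub (amp vx) (amp vy).
Proof.
apply/esym/amp_unique => t xi.
have -> : res iota_inj t (bsub (amp vx) (amp vy) xi) =
  res iota_inj t (amp vx xi) - res iota_inj t (amp vy xi) by exact: l2_ext.
by rewrite !res_amp.
Qed.

Lemma amp_adj x (vx : group_vN x) (vx' : group_vN (badj x)) :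
  amp vx' = badj (amp vx).
Proof. by apply/esym/amp_unique => t xi; rewrite /= res_amp_fun. Qed.

Lemma tau_amp x (vx : group_vN x) : tau (amp vx) = tau x.
Proof. by rewrite /tau !inner_delta /= res_delta1. Qed.

Lemma norm2_amp x (vx : group_vN x) : norm2 (amp vx) = norm2 x.
Proof.
have vx' := group_vN_adj vx; have vxx := group_vN_mul vx' vx.
by rewrite /norm2 -amp_adj -(ampM vx' vx vxx) tau_amp.
Qed.

End AmplificationAlgebra.

(** * Two commuting copies of the finitely supported permutations *)

Section Interleave.
Local Open Scope nat_scope.
Variable b : bool.

(** The action of f on the numbers of parity b, listed as b + 2 m. *)
Definition interleave_fun (f : nat -> nat) (m : nat) : nat :=
  if odd m == b then b + (f m./2).*2 else m.

Lemma interleave_funK f g : cancel f g -> cancel (interleave_fun f) (interleave_fun g).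
Proof.
move=> fg m; rewrite /interleave_fun; case: (odd m =P b) => [<-|/eqP/negbTE->//].
by rewrite oddD odd_double addbF oddb eqxx half_bit_double fg odd_double_half.
Qed.

Fact interleave_subproof (s : finperm) :
  (interleave_fun (val s).1, interleave_fun (val s).2) \in finperm_pred.
Proof.
case: s => -[f g] /= /asboolP/= [fg gf [n fn]]; apply/asboolP; split => /=.
- exact: interleave_funK.
- exact: interleave_funK.
- exists n.*2 => m nm; rewrite /interleave_fun; case: eqP => // <-.
  by rewrite fn ?odd_double_half// -(half_double n) half_leq.
Qed.

Definition interleave (s : finperm) : finperm := FinPerm (interleave_subproof s).

Lemma interleaveM s t : interleave (s * t)%g = (interleave s * interleave t)%g.
Proof.
have e f g : interleave_fun (f \o g) = interleave_fun f \o interleave_fun g.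
  apply/funext => m; rewrite /interleave_fun /=.
  case: (odd m =P b) => [|/eqP/negbTE->//].
  by rewrite oddD odd_double addbF oddb eqxx half_bit_double.
by apply: val_inj; rewrite /= (e (val s).1) (e (val t).2).
Qed.

Lemma interleaveE (s : finperm) m :
  (val (interleave s)).1 (b + m.*2) = b + ((val s).1 m).*2.
Proof. by rewrite /= /interleave_fun oddD odd_double addbF oddb eqxx half_bit_double. Qed.

Lemma finperm_ext (s t : finperm) : (val s).1 =1 (val t).1 -> s = t.
Proof.
case: s t => -[f g] h [[f' g'] h'] /= ff'; apply: val_inj => /=.
have {}ff' : f = f' by apply/funext.
move: h h' => /asboolP/= [fg gf _] /asboolP/= [fg' gf' _]; subst f'.
by congr pair; apply/funext => m; rewrite -{1}[m]gf' fg.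
Qed.

Lemma interleave_inj : injective interleave.
Proof.
move=> s t st; apply: finperm_ext => m; apply: double_inj; apply: (@addnI b).
by rewrite -!interleaveE st.
Qed.

End Interleave.

Lemma interleaveC s t :
  (interleave false s * interleave true t)%g = (interleave true t * interleave false s)%g.
Proof.
apply: finperm_ext => m /=; rewrite /interleave_fun.
by case: (boolP (odd m)) => om; rewrite /= ?om ?oddD ?odd_double ?(negbTE om).
Qed.

Lemma interleave_indep s t : (interleave true t * interleave false s)%g = 1%g -> s = 1%g.
Proof.
move=> /(congr1 (fun u : finperm => (val u).1)) e; apply: finperm_ext => m.
have /= := congr1 (fun f => f m.*2) e; rewrite /interleave_fun odd_double /=.
by rewrite add0n odd_double /= doubleK => /double_inj.
Qed.

(** * The tensor square inside the hyperfinite factor *)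

Record contraction (K : realType) (Gam : groupType) := Contraction {
  contr_op :> bop K Gam;
  contr_vN : group_vN contr_op;
  contr_le : forall xi, l2norm (contr_op xi) <= l2norm xi }.

Section Contractions.
Variables (K : realType) (Gam : groupType).
Implicit Types u v : contraction K Gam.

Definition contr1 : contraction K Gam :=
  Contraction (@group_vN1 K Gam) (fun xi => lexx (l2norm xi)).

Fact contrM_le u v xi : l2norm (bmul u v xi) <= l2norm xi.
Proof. by rewrite /= (le_trans (contr_le _ _))// contr_le. Qed.

Definition contrM u v : contraction K Gam :=
  Contraction (group_vN_mul (contr_vN u) (contr_vN v)) (contrM_le u v).

Fact contrV_le u xi : l2norm (badj u xi) <= l2norm xi.
Proof.
rewrite -[leRHS]mul1r; apply: bstar_le => [|eta]; first exact: ltr01.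
by rewrite mul1r contr_le.
Qed.

Definition contrV u : contraction K Gam :=
  Contraction (group_vN_adj (contr_vN u)) (contrV_le u).

Lemma l2norm_delta (t : Gam) : l2norm (delta t : l2 K Gam) = 1.
Proof.
apply/eqP; rewrite -(@eqrXn2 _ 2)// ?l2norm_ge0// expr1n -inner_norm inner_delta.
by rewrite /= eqxx.
Qed.

Lemma normc_tau_contr u : normc (tau u) <= 1.
Proof.
rewrite /tau inner_delta -(l2norm_delta 1%g).
exact: le_trans (le_l2norm _ _) (contr_le _ _).
Qed.

End Contractions.

Section Tensor.
Variable K : realType.
Local Notation C := (contraction K finperm).
Local Notation B := (bop K finperm).
Implicit Types (u v w : C) (b : bool).

Definition ampb b u : C :=
  Contraction (amp_vN (interleaveM b) (@interleave_inj b) (contr_vN u))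
    (amp_contraction (interleaveM b) (@interleave_inj b) (contr_vN u) (contr_le u)).

Definition tens u v : C := contrM (ampb false u) (ampb true v).

Lemma tensE u v : tens u v = bmul (ampb false u) (ampb true v) :> B.
Proof. by []. Qed.

Lemma lreg_comm (Gam : groupType) (g h : Gam) : (g * h = h * g)%g ->
  bmul (lreg K g) (lreg K h) = bmul (lreg K h) (lreg K g).
Proof.
move=> gh; apply: bop_ext => xi; apply: l2_ext => t /=.
by rewrite !mulgA -!invgM gh.
Qed.

(** Two uses of [lreg_iota_comm] reduce this to translations. *)
Lemma ampbC u v : bmul (ampb false u) (ampb true v) = bmul (ampb true v) (ampb false u).
Proof.
apply: lreg_iota_comm => s; apply: lreg_iota_comm => t.
exact/lreg_comm/interleaveC.
Qed.

Lemma ampbM b u v : ampb b (contrM u v) = bmul (ampb b u) (ampb b v) :> B.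
Proof. exact: ampM. Qed.

Lemma ampb1 b : ampb b (contr1 K finperm) = bop1 K finperm :> B.
Proof. exact: amp1. Qed.

Lemma ampbV b u : ampb b (contrV u) = badj (ampb b u) :> B.
Proof. exact: amp_adj. Qed.

Lemma norm2_ampbB b u v : norm2 (bsub (ampb b u) (ampb b v)) = norm2 (bsub u v).
Proof.
rewrite -(norm2_amp (interleaveM b) (@interleave_inj b)
  (hyperfinite_sub (contr_vN u) (contr_vN v))).
by congr norm2; apply/esym/ampB.
Qed.

Lemma tensM u v u' v' :
  bmul (tens u v) (tens u' v') = tens (contrM u u') (contrM v v') :> B.
Proof.
rewrite !tensE !ampbM -!bmulA; congr bmul.
by rewrite !bmulA ampbC.
Qed.

Lemma tens1 : tens (contr1 K finperm) (contr1 K finperm) = bop1 K finperm :> B.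
Proof. by rewrite tensE !ampb1; exact: bop_ext. Qed.

Lemma tensV u v : badj (tens u v) = tens (contrV u) (contrV v) :> B.
Proof. by rewrite !tensE badjM !ampbV -!badjM ampbC. Qed.

(** The factor 2 is that of [norm2_triangle]. The bound on the first summand
    uses that tau is a trace, through [norm2_mulr]. *)
Lemma norm2_contrMB u v u' v' :
  norm2 (bsub (bmul u v) (bmul u' v')) <=
    2 * norm2 (bsub u u') + 2 * norm2 (bsub v v').
Proof.
apply: le_trans (norm2_triangle _ (bmul u v') _) _; rewrite addrC lerD// ler_pM2l//.
- rewrite [X in norm2 X](_ : _ = bmul (bsub u u') v'); last exact: bop_ext.
  rewrite -[leRHS]mul1r; apply: norm2_mulr => //.
  + exact: hyperfinite_sub (contr_vN _) (contr_vN _).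
  + exact: contr_vN.
  + by move=> xi; rewrite mul1r contr_le.
- rewrite [X in norm2 X](_ : _ = bmul u (bsub v v')); last first.
    by apply: bop_ext => xi /=; rewrite bopB.
  by rewrite -[leRHS]mul1r; apply: norm2_mull => xi; rewrite mul1r contr_le.
Qed.

Lemma norm2_tensB u v u' v' : norm2 (bsub (tens u v) (tens u' v')) <=
  2 * norm2 (bsub u u') + 2 * norm2 (bsub v v').
Proof.
rewrite -(norm2_ampbB false u u') -(norm2_ampbB true v v') !tensE.
exact: (norm2_contrMB (ampb false u) (ampb true v)).
Qed.

(** The restriction to the first copy of the group of a vector supported on
    the second copy is carried by the identity, as the two copies meet
    trivially. *)
Lemma tau_tens u v : tau (tens u v) = tau u * tau v.
Proof.
rewrite /tau !inner_delta /=.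
set w := amp_fun _ _ _ _.
have -> : res (@interleave_inj false) 1%g w = v (delta 1%g) 1%g *: delta 1%g.
  apply: l2_ext => s; rewrite l2Z /= mulg1.
  have [->|s1] := eqVneq s 1%g.
    by rewrite iota1 ?res_delta1 ?mulr1//; exact: interleaveM.
  rewrite res_delta1_out ?mulr0 => [|t /interleave_indep].
    by rewrite bop0.
  by move=> e; rewrite e eqxx in s1.
by rewrite bopZ l2Z mulrC.
Qed.


End Tensor.

(** * Approximable characters *)

Section Approximation.
Variables (K : realType) (G : groupType).
Local Notation C := (contraction K finperm).
Implicit Types (phi psi : G -> K[i]) (F : seq G) (e : K) (g h : G).

Definition almost_rep phi e (u : G -> C) g h : Prop :=
  [/\ norm2 (bsub (u (g * h)%g) (bmul (u g) (u h))) < e,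
      norm2 (bsub (bmul (badj (u g)) (u g)) (bop1 K finperm)) < e,
      norm2 (bsub (bmul (u g) (badj (u g))) (bop1 K finperm)) < e &
      normc (tau (u g) - phi g) < e].

Definition approximable phi : Prop := forall F e, 0 < e ->
  exists u : G -> C, forall g h, g \in F -> h \in F -> almost_rep phi e u g h.

Lemma normcB_le (x y z : K[i]) : normc (x - z) <= normc (x - y) + normc (y - z).
Proof. by rewrite (_ : x - z = (x - y) + (y - z)) ?le_normcD// addrA subrK. Qed.

Lemma approximable_lim phi :
  (forall F e, 0 < e -> exists2 psi, approximable psi &
     forall g, g \in F -> normc (psi g - phi g) < e) ->
  approximable phi.
Proof.
move=> lim F e e0; have e20 : 0 < e / 2 by rewrite divr_gt0.
have he : e / 2 <= e by lra.
have [psi apsi psiF] := lim F _ e20.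
have [u uF] := apsi F _ e20; exists u => g h gF hF.
have [h1 h2 h3 h4] := uF _ _ gF hF; have h5 := psiF _ gF.
split; [exact: lt_le_trans h1 he|exact: lt_le_trans h2 he|
  exact: lt_le_trans h3 he|].
by apply: le_lt_trans (normcB_le _ (psi g) _) _; rewrite (splitr e) ltrD.
Qed.

Lemma approximable_le1 phi g : approximable phi -> normc (phi g) <= 1.
Proof.
move=> aphi; apply/ler_addgt0Pr => e e0.
have [u /(_ g g (mem_head _ _) (mem_head _ _))[_ _ _ h]] := aphi [:: g] e e0.
rewrite -[phi g](subKr (tau (u g))); apply: le_trans (le_normcD _ _) _.
by rewrite normcN; apply: lerD; [exact: normc_tau_contr|exact: ltW].
Qed.

Lemma approximable1 : approximable (fun=> 1).
Proof.
move=> F e e0; exists (fun=> contr1 K finperm) => g h _ _.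
have n0 (x y : bop K finperm) : bfun x =1 bfun y -> norm2 (bsub x y) < e.
  by move=> xy; rewrite norm2E /= xy subrr l2norm0.
split; try exact: n0.
by rewrite /tau inner_delta /= eqxx subrr ComplexField.Normc.normc0.
Qed.

(** The tensor products of the two families work; the factors 2 in
    [norm2_tensB] account for the precision e / 4. *)
Lemma approximableM phi psi : approximable phi -> approximable psi ->
  approximable (fun g => phi g * psi g).
Proof.
move=> aphi apsi F e e0; pose d := e / 4.
have d0 : 0 < d by rewrite divr_gt0.
have [u uF] := aphi F _ d0; have [v vF] := apsi F _ d0.
exists (fun g => tens (u g) (v g)) => g h gF hF.
have [u1 u2 u3 u4] := uF _ _ gF hF; have [v1 v2 v3 v4] := vF _ _ gF hF.
have le (a b a' b' : C) (x y : bop K finperm) : x = tens a b -> y = tens a' b' ->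
    norm2 (bsub a a') < d -> norm2 (bsub b b') < d -> norm2 (bsub x y) < e.
  move=> -> -> aa bb; apply: le_lt_trans (norm2_tensB _ _ _ _) _.
  rewrite (_ : e = 2 * d + 2 * d); last by rewrite /d; field.
  by rewrite ltrD// ltr_pM2l.
split.
- apply: (le _ _ (contrM (u g) (u h)) (contrM (v g) (v h))) u1 v1 => //.
  by rewrite tensM.
- apply: (le (contrM (contrV (u g)) (u g)) (contrM (contrV (v g)) (v g))
    (contr1 K finperm) (contr1 K finperm)) u2 v2.
    by rewrite tensV tensM.
  by rewrite tens1.
- apply: (le (contrM (u g) (contrV (u g))) (contrM (v g) (contrV (v g)))
    (contr1 K finperm) (contr1 K finperm)) u3 v3.
    by rewrite tensV tensM.
  by rewrite tens1.
- rewrite tau_tens.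
  rewrite (_ : _ - _ = tau (u g) * (tau (v g) - psi g) + (tau (u g) - phi g) * psi g).
    apply: le_lt_trans (le_normcD _ _) _.
    rewrite !ComplexField.Normc.normcM.
    rewrite (_ : e = 2 * d + 2 * d); last by rewrite /d; field.
    have d2 : d <= 2 * d by rewrite ler_peMl ?ltW// ltr1n.
    apply: ltrD; apply: lt_le_trans d2.
    + by apply: le_lt_trans v4; rewrite ler_piMl ?normc_ge0 ?normc_tau_contr.
    + apply: le_lt_trans u4; rewrite ler_piMr ?normc_ge0//.
      exact: approximable_le1.
  by rewrite mulrBr mulrBl addrA subrK.
Qed.

Lemma approximableX phi k : approximable phi -> approximable (fun g => phi g ^+ k).
Proof.
move=> aphi; elim: k => [|k IH].
  by under eq_fun do rewrite expr0; exact: approximable1.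
by under eq_fun do rewrite exprS; exact: approximableM.
Qed.

Lemma normcX (z : K[i]) k : normc (z ^+ k) = normc z ^+ k.
Proof.
elim: k => [|k IH]; first by rewrite !expr0 ComplexField.Normc.normc1.
by rewrite !exprS ComplexField.Normc.normcM IH.
Qed.

Lemma exists_expr_lt (r e : K) : 0 <= r -> r < 1 -> 0 < e -> exists k, r ^+ k < e.
Proof.
move=> r0 r1 e0; have /cvg_expr/cvgrPdist_lt : `|r| < 1 by rewrite ger0_norm.
move=> /(_ e e0)[k _ /(_ k (leqnn k))] /=; rewrite sub0r normrN => h.
by exists k; apply: le_lt_trans h; exact: ler_norm.
Qed.

(** Powers of the separating characters bring their values at g below e, and
    multiplying over the elements of F keeps them below e on F, as
    approximable functions have modulus at most 1. *)
Lemma approximable_delta_e :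
  (forall g, g <> 1%g ->
     exists phi, [/\ approximable phi, phi 1%g = 1 & normc (phi g) < 1]) ->
  approximable (@delta_e K G).
Proof.
move=> sep; apply: approximable_lim => F e e0.
have sep_e g : g <> 1%g ->
    exists phi, [/\ approximable phi, phi 1%g = 1 & normc (phi g) < e].
  move=> /sep[phi [aphi phi1 phig]].
  have [k ke] := exists_expr_lt (normc_ge0 _) phig e0.
  exists (fun h => phi h ^+ k); split; first exact: approximableX.
    by rewrite phi1 expr1n.
  by rewrite normcX.
have [phi [aphi phi1 phiF]] : exists phi, [/\ approximable phi, phi 1%g = 1 &
    forall g, g \in F -> g <> 1%g -> normc (phi g) < e].
  elim: F => [|g F [phi [aphi phi1 phiF]]].
    by exists (fun=> 1); split => //; exact: approximable1.
  have [g1|g1] := pselect (g = 1%g).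
    by exists phi; split => // h; rewrite inE => /predU1P[->|/phiF].
  have [psi [apsi psi1 psig]] := sep_e g g1.
  exists (fun h => psi h * phi h); split; first exact: approximableM.
    by rewrite phi1 psi1 mulr1.
  move=> h; rewrite inE ComplexField.Normc.normcM => hgF h1.
  have n1 := approximable_le1 h aphi; have n2 := approximable_le1 h apsi.
  case/predU1P: hgF => [hg|/phiF/(_ h1) hF].
    apply: le_lt_trans (_ : normc (psi h) < e); last by rewrite hg.
    by rewrite ler_piMr ?normc_ge0.
  by apply: le_lt_trans hF; rewrite ler_piMl ?normc_ge0.
exists phi => // g gF; rewrite /delta_e; have [->|/eqP g1] := eqVneq g 1%g.
  by rewrite phi1 subrr ComplexField.Normc.normc0.
by rewrite subr0; exact: phiF.
Qed.

End Approximation.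

Local Notation "x %:C" := (real_complex _ x) : ring_scope.

(** * A Newton step towards the polar part *)

Section Newton.
Variables (K : realType) (T : choiceType).
Implicit Types (x : bop K T) (xi eta : l2 K T) (c t : K).

Lemma innerZr (a : K[i]) xi eta : inner xi (a *: eta) = conjc a * inner xi eta.
Proof. by rewrite inner_conj innerZl rmorphM [inner xi eta]inner_conj. Qed.

Lemma l2norm_realB (p q : K) xi eta :
  l2norm (p%:C *: xi - q%:C *: eta) ^+ 2 =
  p ^+ 2 * l2norm xi ^+ 2 - 2 * p * q * complex.Re (inner xi eta) +
  q ^+ 2 * l2norm eta ^+ 2.
Proof.
rewrite -!inner_norm !(innerBl, innerBr, innerZl, innerZr) (inner_conj xi eta).
case: (inner xi xi) (inner xi eta) (inner eta eta) => [a b] [r s] [u v] /=.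
by ring.
Qed.

Fact bscale_bounded (a : K[i]) x :
  exists M : K, forall xi, l2norm (a *: x xi) <= M * l2norm xi.
Proof.
have [M xM] := bop_bounded x; exists (normc a * M) => xi.
by rewrite l2normZ -mulrA ler_wpM2l ?normc_ge0.
Qed.

Fact bscale_linear (a : K[i]) x : linear (fun xi => a *: x xi).
Proof. by move=> b xi eta; rewrite bop_linear scalerDr !scalerA mulrC. Qed.

Fact bscale_adjoint (a : K[i]) x xi eta :
  inner (a *: x xi) eta = inner xi (conjc a *: bstar x eta).
Proof. by rewrite innerZl innerZr conjcK bop_adjoint. Qed.

Definition bscale (a : K[i]) x : bop K T :=
  Bop (bscale_linear a x) (bscale_bounded a x) (bscale_adjoint a x).

(** The operator x (1 + c - c x* x). For c = 1/2 it is the Newton-Schulz step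
    for the polar part of x. *)
Definition newton c x : bop K T :=
  bsub (bscale (1 + c)%:C x) (bscale c%:C (bmul x (bmul (badj x) x))).

(** By functional calculus, s := x* x <= t has to imply
    s (1 + c - c s)^2 <= t / 4. The constant c is chosen so that the
    polynomial identity
    t^3 / (3t - 4)^2 - s (1 + c - c s)^2 = c^2 (t - s) (s - t/4)^2 holds, whose
    right-hand side is nonnegative; and t^3 / (3t - 4)^2 <= t / 4 for t >= 4.
    The identity is used in vector form, by applying the bound on x to
    (s - t/4) xi. *)
Lemma newton_le t x : 4 <= t ->
  (forall xi, l2norm (x xi) ^+ 2 <= t * l2norm xi ^+ 2) ->
  forall xi, l2norm (newton (4 / (3 * t - 4)) x xi) ^+ 2 <= t / 4 * l2norm xi ^+ 2.
Proof.
move=> t4 xt xi; set w := 3 * t - 4; have w0 : 0 < w by rewrite /w; lra.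
rewrite /= l2norm_realB; set a := bstar x (x xi).
have -> : complex.Re (inner (x xi) (x a)) = l2norm a ^+ 2.
  by rewrite -bstar_adjoint inner_norm.
have := xt (1%:C *: a - (t / 4)%:C *: xi).
rewrite (l2norm_realB 1 (t / 4) a xi).
rewrite (bopB x).
rewrite (bopZ x 1%:C a) (bopZ x (t / 4)%:C xi).
rewrite (l2norm_realB 1 (t / 4) (x a) (x xi)).
have -> : complex.Re (inner (x a) (x xi)) = l2norm a ^+ 2.
  by rewrite bop_adjoint inner_norm.
have -> : complex.Re (inner a xi) = l2norm (x xi) ^+ 2.
  by rewrite bstar_adjoint inner_norm.
have := sqr_ge0 (l2norm xi).
move: (l2norm xi ^+ 2) (l2norm (x xi) ^+ 2) (l2norm a ^+ 2) (l2norm (x a) ^+ 2).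
move=> A B C D A0 h; rewrite -(ler_pM2l (exprn_gt0 2 w0)).
have -> : w ^+ 2 * ((1 + 4 / w) ^+ 2 * B - 2 * (1 + 4 / w) * (4 / w) * C +
    (4 / w) ^+ 2 * D) = 9 * t ^+ 2 * B - 24 * t * C + 16 * D.
  by rewrite /w; field; rewrite -/w gt_eqF.
apply: (@le_trans _ _ (t ^+ 3 * A)).
  clear -h; lra.
rewrite mulrA ler_wpM2r//.
have -> : t ^+ 3 = (2 * t) ^+ 2 * (t / 4) by field.
rewrite ler_wpM2r ?divr_ge0//; first by lra.
by rewrite ler_pXn2r// ?nnegrE ?(ltW w0) /w; lra.
Qed.

End Newton.

Section NewtonVN.
Variables (K : realType) (Gam : groupType).
Implicit Types (x : bop K Gam) (c t : K).

Lemma group_vN_newton c x : group_vN x -> group_vN (newton c x).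
Proof.
move=> vx z cz; apply: bop_ext => xi /=.
have comm (y : bop K Gam) eta : group_vN y -> y (z eta) = z (y eta).
  by move=> vy; have /(congr1 (fun u : bop K Gam => u eta)) := vy z cz.
have cx' eta : bstar x (z eta) = z (bstar x eta).
  exact: (comm (badj x)) (group_vN_adj vx).
by rewrite !(comm x)// cx' (comm x)// bopB !(bopZ z).
Qed.

(** A step moves x by c x (1 - x* x), which is small if x is nearly
    isometric in the 2-norm. *)
Lemma norm2_newtonB c t x : 0 <= c -> 0 <= t ->
  (forall xi, l2norm (x xi) ^+ 2 <= t * l2norm xi ^+ 2) ->
  norm2 (bsub (newton c x) x) <=
  c * Num.sqrt t * norm2 (bsub (bmul (badj x) x) (bop1 K Gam)).
Proof.
move=> c0 t0 xt; rewrite !norm2E /=; set d := delta 1%g.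
rewrite (_ : _ - _ = (- c)%:C *: x (bstar x (x d) - d)); last first.
  rewrite bopB scalerBr !rmorphN rmorphD /= !scaleNr opprK scalerDl scale1r.
  by rewrite -addrA [- _ - _]addrC addrA [x d + _]addrC addrK addrC.
rewrite l2normZ /= expr0n addr0 sqrrN sqrtr_sqr (ger0_norm c0) -mulrA ler_wpM2l//.
rewrite -(@ler_pXn2r _ 2)// ?nnegrE ?mulr_ge0 ?l2norm_ge0 ?sqrtr_ge0//.
by rewrite exprMn (sqr_sqrtr t0); exact: xt.
Qed.

End NewtonVN.

(** * Contractive representatives of unitaries of the ultrapower *)

Section Lift.
Variables (K : realType) (rho : free_ultrafilter).
Local Notation pi x := (\pi_(ultrapower K rho) x)%qT.
Implicit Types x y : linf K.

Local Instance free_ultra : UltraFilter rho := uf_ultra rho.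
Local Instance free_proper : ProperFilter rho := ultra_proper.

Lemma pi_near x y : pi x = pi y -> forall e : K, 0 < e ->
  \forall n \near (rho : set_system nat), norm2 (bsub (x n) (y n)) < e.
Proof.
move=> /null_eqP/asboolP/cvgrPdist_lt xy e e0; apply: filterS (xy e e0) => n /=.
by rewrite sub0r normrN ger0_norm// norm2_ge0.
Qed.

Lemma newton_lift t x : 4 <= t ->
  (forall n xi, l2norm (x n xi) ^+ 2 <= t * l2norm xi ^+ 2) ->
  umul (uadj (pi x)) (pi x) = uone K rho ->
  exists y, pi y = pi x /\
    forall n xi, l2norm (y n xi) ^+ 2 <= t / 4 * l2norm xi ^+ 2.
Proof.
move=> t4 xt; rewrite pi_uadj pi_umul pi_uone => /null_eqP/asboolP ux.
have t0 : 0 <= t by apply: le_trans t4.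
have t40 : 0 <= t / 4 by rewrite divr_ge0.
pose c : K := 4 / (3 * t - 4).
have c0 : 0 <= c by rewrite divr_ge0//; lra.
have yt n := newton_le t4 (xt n).
have yM : exists M : K, forall n xi, l2norm (newton c (x n) xi) <= M * l2norm xi.
  exists (Num.sqrt (t / 4)) => n xi.
  rewrite -(@ler_pXn2r _ 2)// ?nnegrE ?mulr_ge0 ?l2norm_ge0 ?sqrtr_ge0//.
  by rewrite exprMn (sqr_sqrtr t40); exact: yt.
exists (Linf (fun n => group_vN_newton c (linf_in x n)) yM); split; last exact: yt.
apply/null_eqP/asboolP.
apply: (rho_squeeze (C := c * Num.sqrt t) (D := 0) _ ux ux) => n.
by rewrite norm2_ge0 mul0r addr0; exact: norm2_newtonB.
Qed.

(** A bound ||x||^2 <= 4^k on all coordinates is brought down to 1 by k Newton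
    steps. *)
Lemma contraction_lift (v : ultrapower K rho) : umul (uadj v) v = uone K rho ->
  exists y, pi y = v /\ forall n xi, l2norm (y n xi) <= l2norm xi.
Proof.
have [x <-] : exists x, pi x = v by exists (repr v); rewrite reprK.
have [M M0 xM] := linf_bounded_gt0 x.
have [k Mk] : exists k, M ^+ 2 <= 4 ^+ k.
  exists (Num.bound (M ^+ 2)); apply: le_trans (ltW (upper_nthrootP (leqnn _))) _.
  by rewrite lerXn2r// ?nnegrE// ler_nat.
have {M M0 Mk xM}: forall n xi, l2norm (x n xi) ^+ 2 <= 4 ^+ k * l2norm xi ^+ 2.
  move=> n xi; apply: le_trans (_ : M ^+ 2 * l2norm xi ^+ 2 <= _).
    by rewrite -exprMn ler_pXn2r// ?nnegrE ?mulr_ge0 ?l2norm_ge0// ltW.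
  by rewrite ler_wpM2r// sqr_ge0.
elim: k x => [|k IH] x xk ux.
  exists x; split => // n xi.
  by have := xk n xi; rewrite expr0 mul1r ler_pXn2r// nnegrE l2norm_ge0.
have [|y [yx yk]] := newton_lift _ xk ux.
  by rewrite exprS ler_peMr// exprn_ege1// ler1n.
rewrite -yx in ux *; apply: IH => // n xi; apply: le_trans (yk n xi) _.
by rewrite exprS [4 * _]mulrC mulfK// pnatr_eq0.
Qed.

End Lift.

Section Microstates.
Variables (K : realType) (G : groupType).
Implicit Types (phi : G -> K[i]).

Lemma hyperlinear_pair_approximable phi :
  hyperlinear_pair phi -> approximable phi.
Proof.
move=> [_ [rho [theta [uth hom tr]]]] F e e0.
pose pi x := (\pi_(ultrapower K rho) x)%qT.
have FP : ProperFilter (rho : set_system nat) := free_proper rho.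
have /choice[y yP] g : exists y : linf K, pi y = theta g /\
    forall n xi, l2norm (y n xi) <= l2norm xi.
  by apply: contraction_lift; have [] := uth g.
pose u n g := Contraction (linf_in (y g) n) ((yP g).2 n).
have near_gh g h : \forall n \near (rho : set_system nat), almost_rep phi e (u n) g h.
  have n1 : \forall n \near (rho : set_system nat),
      norm2 (bsub (y (g * h)%g n) (lmul (y g) (y h) n)) < e.
    apply: pi_near => //.
    by rewrite -pi_umul [LHS](yP _).1 hom -(yP g).1 -(yP h).1.
  have n2 : \forall n \near (rho : set_system nat),
      norm2 (bsub (lmul (ladj (y g)) (y g) n) (linf1 K n)) < e.
    apply: pi_near => //.
    rewrite -pi_umul -pi_uadj -pi_uone; have [+ _] := uth g.
    by rewrite -(yP g).1.
  have n3 : \forall n \near (rho : set_system nat),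
      norm2 (bsub (lmul (y g) (ladj (y g)) n) (linf1 K n)) < e.
    apply: pi_near => //.
    rewrite -pi_umul -pi_uadj -pi_uone; have [_ +] := uth g.
    by rewrite -(yP g).1.
  have n4 : \forall n \near (rho : set_system nat), normc (tau (y g n) - phi g) < e.
    have [l yl] := tau_cvg rho (y g).
    have -> : phi g = l by rewrite -tr -(yP g).1; exact: pi_utrace.
    move/cvgrPdist_lt: yl => /(_ (real_complex K e)).
    rewrite ltcR => /(_ e0); apply: filterS => n /=.
    rewrite -normcN opprB; case: (l - tau _) => a b.
    by rewrite normc_def ltcR.
  apply: filterS2 (filterI n1 n2) (filterI n3 n4) => n [h1 h2] [h3 h4].
  exact: And4 h1 h2 h3 h4.
have near_all (A : seq (G * G)) : \forall n \near (rho : set_system nat),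
    forall p, p \in A -> almost_rep phi e (u n) p.1 p.2.
  elim: A => [|p A IH]; first by apply: filterE.
  apply: filterS2 (near_gh p.1 p.2) IH => n pn An q.
  by rewrite inE => /predU1P[->//|/An].
have [n nP] := filter_ex (near_all [seq (g, h) | g <- F, h <- F]).
by exists (u n) => g h gF hF; apply: (nP (g, h)); exact: allpairs_f.
Qed.

End Microstates.

(** * Ultraproducts of approximations *)

Lemma exists_free_ultrafilter :
  exists rho : free_ultrafilter, (\oo : set_system nat) `<=` rho.
Proof.
have [U [uU ooU]] := ultraFilterLemma (eventually_filter : ProperFilter \oo).
have Ufree n : ~ U [set n].
  move=> Un; have Un' : U [set m | (n < m)%N] by apply: ooU; exists n.+1.
  by have [m [/= ->]] := filter_ex (filterI Un Un'); rewrite ltnn.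
by exists (FreeUltrafilter uU Ufree).
Qed.

Section Ultraproduct.
Variables (K : realType) (G : groupType).
Implicit Types (phi : G -> K[i]).

(** The sets F n contain all elements numbered below n, so every relation
    between elements of G holds up to 1/(n+1) for all large n, hence exactly in
    the ultrapower. *)
Lemma approximable_hyperlinear_pair phi : countable [set: G] ->
  central_pair phi -> approximable phi -> hyperlinear_pair phi.
Proof.
move=> /countable_injP[f f_inj] cphi aphi; split=> //.
have [F FP] : exists F : nat -> seq G, forall n g, (f g < n)%N -> g \in F n.
  have {f_inj} finj : injective f by move=> g h; apply: f_inj; rewrite inE.
  suff /choice[F FP] : forall n, exists s : seq G, forall g, (f g < n)%N -> g \in s.
    by exists F.
  elim=> [|n [s sP]]; first by exists [::].
  have [[g gn]|nog] := pselect (exists g, f g = n).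
    exists (g :: s) => h; rewrite ltnS leq_eqVlt inE => /orP[/eqP hn|/sP->].
      by rewrite (finj h g) ?eqxx// gn.
    by rewrite orbT.
  exists s => g; rewrite ltnS leq_eqVlt => /orP[/eqP gn|/sP//].
  by case: nog; exists g.
have e0 n : 0 < n.+1%:R^-1 :> K by rewrite invr_gt0.
have /choice[u uP] n := aphi (F n) _ (e0 n).
have {}uP g h : exists n0, forall n, (n0 <= n)%N ->
    almost_rep phi n.+1%:R^-1 (u n) g h.
  by exists (maxn (f g) (f h)).+1 => n; rewrite gtn_max => /andP[gn hn];
    apply: uP; exact: FP.
have [rho oorho] := exists_free_ultrafilter; exists rho.
pose pi x := (\pi_(ultrapower K rho) x)%qT.
have rhoF : Filter (rho : set_system nat) := @filter_filter _ _ (free_proper rho).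
have to0 (a : nat -> K) :
    (exists n0, forall n, (n0 <= n)%N -> `|a n| < n.+1%:R^-1) ->
    a n @[n --> (rho : set_system nat)] --> (0 : K).
  move=> [n0 an]; apply/cvgrPdist_lt => e e_gt0; apply: oorho.
  near=> n; rewrite sub0r normrN; apply: lt_trans (an n _) _.
    by near: n; exact: nbhs_infty_ge.
  by near: n; exact: (near_infty_natSinv_lt (PosNum e_gt0)).
have u_bounded g : exists M : K, forall n xi, l2norm (u n g xi) <= M * l2norm xi.
  by exists 1 => n xi; rewrite mul1r contr_le.
pose y g := Linf (fun n => contr_vN (u n g)) (u_bounded g).
have pi_eq (x z : linf K) : (exists n0, forall n, (n0 <= n)%N ->
    norm2 (bsub (x n) (z n)) < n.+1%:R^-1) -> pi x = pi z.
  move=> [n0 xz]; apply/null_eqP/asboolP/to0; exists n0 => n /xz.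
  by rewrite ger0_norm// norm2_ge0.
exists (fun g => pi (y g)); split.
- move=> g; have [n0 n0P] := uP g g; rewrite /unitary /pi.
  rewrite pi_uadj (pi_umul rho (ladj (y g)) (y g)) (pi_umul rho (y g) (ladj (y g))).
  rewrite pi_uone; split.
  + apply: (pi_eq (lmul (ladj (y g)) (y g)) (linf1 K)).
    by exists n0 => n /n0P[_ h _ _]; exact: h.
  + apply: (pi_eq (lmul (y g) (ladj (y g))) (linf1 K)).
    by exists n0 => n /n0P[_ _ h _]; exact: h.
- move=> g h; have [n0 n0P] := uP g h; rewrite /pi (pi_umul rho (y g) (y h)).
  apply: (pi_eq (y (g * h)%g) (lmul (y g) (y h))).
  by exists n0 => n /n0P[k _ _ _]; exact: k.
- move=> g; have [n0 n0P] := uP g g; apply: pi_utrace.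
  have small (r : K[i] -> K) : (forall z, `|r z| <= normc z) ->
      r (tau (u n g) - phi g) @[n --> (rho : set_system nat)] --> (0 : K).
    move=> rle; apply: to0; exists n0 => n /n0P[_ _ _].
    exact: le_lt_trans.
  by apply: rho_cvgC; apply/subr_cvg0; [under eq_fun do rewrite -raddfB|
    under eq_fun do rewrite -raddfB]; apply: small => z; have [] := norm_Re_Im_le z.
Unshelve. all: by end_near.
Qed.

(** Grouping the indices by the value of g turns the form into a sum of
    squared moduli; [k i] is a representative of the class of i. *)
Lemma positive_definite_delta_e : positive_definite (@delta_e K G).
Proof.
move=> n g c; pose k i := odflt i [pick j | g j == g i].
have gk i : g (k i) = g i by rewrite /k; case: pickP => [j /eqP|].
have kE i j : ((g i)^-1 * g j == 1)%g = (k j == k i).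
  apply/eqP/eqP => [gij|kij].
    have gg : g j = g i by rewrite -[LHS](mulVKg (g i)) gij mulg1.
    rewrite /k gg; case: pickP => // /(_ i); by rewrite eqxx.
  by rewrite -(gk j) kij gk mulVg.
pose S m := \sum_(i < n | k i == m) c i.
rewrite (_ : \sum_i _ = \sum_m conjc (S m) * S m).
  by apply: sumr_ge0 => m _; rewrite mulrC -sqr_normc exprn_ge0.
rewrite (partition_big k xpredT)//=; apply: eq_bigr => m _.
rewrite /S rmorph_sum mulr_suml; apply: eq_bigr => i /eqP <-.
rewrite mulr_sumr [RHS]big_mkcond; apply: eq_bigr => j _.
by rewrite /delta_e kE; case: (k j == k i); rewrite ?mulr1 ?mulr0.
Qed.

Lemma central_pair_delta_e : central_pair (@delta_e K G).
Proof.
split; first exact: positive_definite_delta_e.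
- move=> g h; rewrite /delta_e; congr (_%:R); congr nat_of_bool.
  apply/eqP/eqP => [e|->]; last by rewrite mulg1 mulVg.
  by apply: (mulgI h^-1%g); apply: (mulIg h); rewrite e mulg1 mulVg.
- by rewrite /delta_e eqxx.
Qed.

End Ultraproduct.

Lemma normC_lt1 (K : realType) (z : K[i]) : (`|z| < 1) = (normc z < 1).
Proof. by case: z => a b; rewrite normc_def -(ltcR _ 1). Qed.

Theorem proposition2p13 (K : realType) (G : groupType)
    (G_countable : countable [set: G]) :
  hyperlinear K G <->
  (forall g : G, g <> 1%g ->
     exists phi : G -> K[i], hyperlinear_pair phi /\ `|phi g| < 1).
Proof.
split=> [hypG g /eqP/negbTE g1|sep].
  by exists (@delta_e K G); split => //; rewrite /delta_e g1 normr0.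
apply: approximable_hyperlinear_pair => //; first exact: central_pair_delta_e.
apply: approximable_delta_e => g /sep[phi [hphi phig]].
exists phi; split; first exact: hyperlinear_pair_approximable.
  by have [[_ _ ->]] := hphi.
by rewrite -normC_lt1.
Qed.
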